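(* Let $G=(V,E)$ be a finite connected graph with $|V|=n$, and consider the edge-averaging process $(f_t)_{t\ge 0}$ on $G$. Suppose that the initial opinions $\{f_0(v)\}_{v\in V}$ are i.i.d.\ random variables satisfying $|f_0(v)|\le 1$ almost surely. Then for every $\varepsilon>0$, $$\mathbb{E}[\tau_\varepsilon]\le C\,\frac{\log^2(n)}{\varepsilon^4},$$ where $C>0$ is a universal constant.
   Context: Edge-averaging process: each vertex $v\in V$ carries an opinion $f_t(v)\in\mathbb R$ at each time $t\ge 0$. Each edge carries an independent rate-one Poisson clock (clocks independent of the initial opinions). When the clock of edge $\{u,v\}$ rings at time $t$, both endpoints update to $f_t(u)=f_t(v)=\frac{f_{t-}(u)+f_{t-}(v)}{2}$, where $f_{t-}(u)=\lim_{s\uparrow t}f_s(u)$; other opinions are unchanged. For $f:V\to\mathbb R$, $\mathrm{osc}(f):=\sup_{u,v\in V}|f(u)-f(v)|$, and the $\varepsilon$-consensus time is $\tau_\varepsilon:=\min\{t\ge 0:\mathrm{osc}(f_t)\le\varepsilon\}$. *)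

(* Defs.v *)
From HB Require Import structures.
From mathcomp Require Import all_boot all_order all_algebra.
From mathcomp Require Import all_classical all_reals all_analysis.
From mathcomp Require Import exponential_distribution.
From mathcomp Require Import Rstruct Rstruct_topology.

Set Implicit Arguments.
Unset Strict Implicit.
Unset Printing Implicit Defensive.

Import Order.TTheory GRing.Theory Num.Theory.
Local Open Scope ring_scope.

Definition edge_rel (V : finType) (E : {set {set V}}) : rel V :=
  fun x y => [set x; y] \in E.

Definition simple_graph (V : finType) (E : {set {set V}}) : Prop :=
  forall k, k \in E -> #|k| = 2%N.

Definition connected_graph (V : finType) (E : {set {set V}}) : Prop :=
  forall u v : V, connect (edge_rel E) u v.

Section Deterministic.
Context {R : realType} {V : finType}.

Definition osc (f : V -> R) : R :=
  \big[Num.max/0]_(u : V) \big[Num.max/0]_(v : V) `|f u - f v|.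

(* when the clock of the edge k = {u,v} rings, both endpoints take the value
   (f u + f v)/2 = (sum_{w in k} f w) / |k|; other opinions are unchanged *)
Definition edge_avg (f : V -> R) (k : {set V}) : V -> R :=
  fun v => if v \in k then (\sum_(w in k) f w) / #|k|%:R else f v.

(* The (pathwise) edge-averaging process.  rt k m is the time of the        *)
(* (m+1)-th ring of the clock of the edge k.  Events are processed in time   *)
(* order: in state c (c k = number of rings of k already used) the next      *)
(* event is a ring of an edge k whose next ring time rt k (c k) is minimal  *)
(* (ties, a null event, are broken arbitrarily by [pick]).                  *)

Variables (E : {set {set V}}) (rt : {set V} -> nat -> R) (f0 : V -> R).

Definition next_edge (c : {set V} -> nat) : option {set V} :=
  [pick k in E | [forall k' in E, rt k (c k) <= rt k' (c k')]].

Fixpoint ev (j : nat) : (V -> R) * ({set V} -> nat) :=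
  if j is j'.+1 then
    let: (f, c) := ev j' in
    if next_edge c is Some k then
      (edge_avg f k, fun k' => if k' == k then (c k).+1 else c k')
    else (f, c)
  else (f0, fun _ => 0%N).

Definition ev_time (j : nat) : option R :=
  let c := (ev j).2 in omap (fun k => rt k (c k)) (next_edge c).

Definition process_at (t : R) (g : V -> R) : Prop :=
  exists j : nat, g = (ev j).1
    /\ (forall i, (i < j)%N -> exists2 s, ev_time i = Some s & s <= t)
    /\ (forall s, ev_time j = Some s -> t < s).

(* tau_eps = min { t >= 0 : osc f_t <= eps }  (+oo if the set is empty) *)
Definition consensus_time (eps : R) : \bar R :=
  ereal_inf [set t%:E | t in
    [set t : R | 0 <= t /\ exists g, process_at t g /\ osc g <= eps]]%classic.

End Deterministic.

Definition mutually_independent d (T : measurableType d) (R : realType)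
    (P : probability T R) (I : eqType) (J : set I) (Y : I -> T -> R) : Prop :=
  forall (s : seq I), uniq s -> (forall i, i \in s -> J i) ->
  forall B : I -> set R, (forall i, measurable (B i)) ->
  P (\bigcap_(i in [set` s]) (Y i @^-1` B i))%classic =
  (\prod_(i <- s) P (Y i @^-1` B i)%classic)%E.

(* index set of the family: initial opinions (inl v) and the interarrival
   times of the clocks of the edges (inr (k, m)) *)
Definition ea_index (V : finType) (E : {set {set V}}) : set (V + ({set V} * nat)) :=
  fun i => match i with inl _ => True | inr km => km.1 \in E end.

Notation RR := (Rdefinitions.R : realType).

(* Main.v *)
Require Import Defs.
From HB Require Import structures.
From mathcomp Require Import all_boot all_order all_algebra.
From mathcomp Require Import all_classical all_reals all_analysis.
From mathcomp Require Import measurable_realfun exponential_distribution.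
From mathcomp Require Import Rstruct Rstruct_topology.
From mathcomp Require Import ring lra.

(** The memoryless property reduces the process to its jump chain, in which the
rings are i.i.d. uniform edges, so that with [d] edges
[E tau <= (1/d) sum_j P(osc f_j > eps)] up to a constant.  By duality
[f_j(v)] is the initial opinion integrated against the mass distribution
[m_j] obtained from a unit mass at [v] by averaging along the reversed edge
sequence, which has the same law.  Given the edges, Hoeffding's inequality
bounds the deviation of [f_j(v)] from the mean opinion in terms of
[S_j = |m_j - 1/n|^2], and it remains to bound exponential moments of [S_j].
Some path leads from a vertex of maximal mass down to average mass with
at most [2/S] edges, so averaging dissipates [S] at rate at least
[c S^3]; running the exponential supermartingale [exp(theta_t S)] with
[theta_t] linear in [t] yields [E exp(theta S_t) <= exp(C theta/sqrt t)],
hence [P(osc f_t > eps) <= 2n exp(-c eps^2 sqrt t)], which is summed in [t]. *)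

Set Implicit Arguments.
Unset Strict Implicit.
Unset Printing Implicit Defensive.

Import Order.TTheory GRing.Theory Num.Theory.
Local Open Scope classical_set_scope.
Local Open Scope ring_scope.

(** * Averaging operators: duality, contraction, energy identity *)

Section EdgeAveraging.
Context {R : realType} {V : finType}.
Implicit Types (f m : V -> R) (e : {set V}) (s : seq {set V}) (c : R).

(** A bound on the mean of [S_j] would not suffice: a union over the [n] vertices is affordable only
    if each failure is exponentially unlikely. The heuristic [S' = - c S^3] makes [S] of order
    [t^(-1/2)], so that Hoeffding's exponent [eps^2 / S] is of order [eps^2 sqrt t] and passes
    [log n] when [t] is of order [log^2 n / eps^4]. The optimal Chernoff parameter is of order
    [eps sqrt t]; Hoeffding squares it into an exponent of order [eps^2 t] in front of [S], hence a
    linear ramp whose slope is of order [eps^2].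

    The jump chain never appears as a random process. Expectations over edge sequences and opinions
    are finite sums, tied to the probability space by one exact formula for the joint law of
    opinions and ring order. On the side of the opinions finiteness is gained by rounding to a grid,
    at the price of replacing [eps] by [eps / 2]. The consensus time is not shown to be measurable:
    it is bounded almost surely by a measurable series, whose integral is estimated. *)

Definition act s f : V -> R := foldr (fun e h => edge_avg h e) f s.

Definition sqdev f : R := \sum_v (f v - #|V|%:R^-1) ^+ 2.

Definition prob_vec f : Prop := (forall v, 0 <= f v) /\ \sum_v f v = 1.

(** Averaging is a symmetric operator: on [e] both sides contribute the product of the two sums over
    [e] divided by [#|e|], and off [e] nothing moves. *)
Lemma edge_avg_dual m f e :
  \sum_v edge_avg m e v * f v = \sum_v m v * edge_avg f e v.
Proof.
rewrite (bigID (mem e)) [RHS](bigID (mem e)) /=; congr (_ + _); last first.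
  by apply: eq_bigr => v /negbTE ve; rewrite /edge_avg ve.
transitivity ((\sum_(w in e) m w) * (\sum_(v in e) f v) / #|e|%:R).
  rewrite mulrAC mulr_sumr; apply: eq_bigr => v ve.
  by rewrite /edge_avg ve.
by rewrite -mulrA mulr_suml; apply: eq_bigr => v ve; rewrite /edge_avg ve.
Qed.

(** The head of a word is its most recent edge, so [act] lets the last letter act first; taking
    adjoints reverses this order. *)
Lemma act_dual s m f :
  \sum_v act s m v * f v = \sum_v m v * act (rev s) f v.
Proof.
elim: s f => [//|e s IH] f.
rewrite /= edge_avg_dual IH rev_cons; apply: eq_bigr => v _; congr (_ * _).
by rewrite /act foldr_rcons.
Qed.

Lemma edge_avg_cst c e : edge_avg (fun=> c) e = (fun=> c) :> (V -> R).
Proof.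
apply/funext => v; rewrite /edge_avg; case: ifP => // ve.
rewrite sumr_const -[c *+ _]mulr_natr mulfK // pnatr_eq0 -lt0n.
by apply/card_gt0P; exists v.
Qed.

Lemma edge_avg_sum f e : \sum_v edge_avg f e v = \sum_v f v.
Proof.
have := edge_avg_dual f (fun=> 1) e; rewrite edge_avg_cst.
by under eq_bigr do rewrite mulr1; under [RHS]eq_bigr do rewrite mulr1.
Qed.

Lemma act_sum s f : \sum_v act s f v = \sum_v f v.
Proof. by elim: s => //= e s <-; rewrite edge_avg_sum. Qed.

Lemma edge_avg_mono f m e :
  (forall v, f v <= m v) -> forall v, edge_avg f e v <= edge_avg m e v.
Proof.
move=> fm v; rewrite /edge_avg; case: ifP => // _.
by rewrite ler_wpM2r ?invr_ge0 // ler_sum.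
Qed.

Lemma act_mono s f m :
  (forall v, f v <= m v) -> forall v, act s f v <= act s m v.
Proof. by move=> fm; elim: s => [//|e s IH] /=; apply: edge_avg_mono. Qed.

Lemma edge_avg_addc f c e v :
  edge_avg (fun u => f u + c) e v = edge_avg f e v + c.
Proof.
rewrite /edge_avg; case: ifP => // ve.
rewrite big_split /= sumr_const mulrDl -[c *+ _]mulr_natr mulfK //.
by rewrite pnatr_eq0 -lt0n; apply/card_gt0P; exists v.
Qed.

Lemma act_addc s f c v : act s (fun u => f u + c) v = act s f v + c.
Proof.
elim: s v => [//|e s IH] v /=.
by rewrite -edge_avg_addc; congr (edge_avg _ e v); apply/funext.
Qed.

Lemma act_cst s c : act s (fun=> c) = (fun=> c) :> (V -> R).
Proof. by elim: s => //= e s ->; rewrite edge_avg_cst. Qed.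

(** A monotone map that commutes with adding constants is a contraction in the sup norm. This
    controls the effect of rounding the initial opinions. *)
Lemma act_dist_le s f m c : (forall v, `|f v - m v| <= c) ->
  forall v, `|act s f v - act s m v| <= c.
Proof.
move=> fm v; rewrite ler_norml; apply/andP; split.
  rewrite lerBrDl -act_addc; apply: act_mono => u.
  by have := fm u; rewrite ler_norml => /andP[]; lra.
rewrite lerBlDl -act_addc; apply: act_mono => u.
by have := fm u; rewrite ler_norml => /andP[]; lra.
Qed.

Lemma act_prob_vec s f : prob_vec f -> prob_vec (act s f).
Proof.
case=> f0 f1; split; last by rewrite act_sum.
move=> v; have := @act_mono s (fun=> 0) f f0 v.
by rewrite act_cst.
Qed.

Lemma sqdev_edge_avg f (u v : V) : u != v ->
  sqdev (edge_avg f [set u; v]%SET) = sqdev f - (f u - f v) ^+ 2 / 2.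
Proof.
move=> uv; rewrite /sqdev.
set n := _^-1.
rewrite (bigD1 u) //= (bigD1 v) 1?eq_sym //=.
rewrite [in RHS](bigD1 u) //= [in RHS](bigD1 v) 1?eq_sym //=.
have H w : w \in [set u; v]%SET -> edge_avg f [set u; v]%SET w = (f u + f v) / 2.
  by move=> we; rewrite /edge_avg we cards2 uv big_setU1 ?inE //= big_set1.
rewrite !H ?set21 ?set22 //.
rewrite (eq_bigr (fun i => (f i - n) ^+ 2)); last first.
  move=> i /andP[iu iv]; rewrite /edge_avg ifF //.
  by rewrite !inE (negbTE iu) (negbTE iv).
set r := \sum_(_ | _) _.
by field.
Qed.

Lemma sqdev_ge0 f : 0 <= sqdev f.
Proof. by apply: sumr_ge0 => v _; apply: sqr_ge0. Qed.

Lemma osc_gtP f c : 0 <= c -> c < osc f -> exists u v, c < `|f u - f v|.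
Proof.
move=> c0; rewrite /osc => H; apply: contrapT => NH; move: H; apply/negP.
rewrite -leNgt; apply/bigmax_leP; split=> // u _.
apply/bigmax_leP; split=> // v _; rewrite leNgt; apply/negP => H.
by apply: NH; exists u, v.
Qed.

Lemma osc_le f c : 0 <= c -> (forall u v, `|f u - f v| <= c) -> osc f <= c.
Proof.
move=> c0 H; apply/bigmax_leP; split=> // u _.
by apply/bigmax_leP; split=> // v _.
Qed.

Lemma osc_ge f u v : `|f u - f v| <= osc f.
Proof.
rewrite /osc; apply: le_trans (le_bigmax _ _ u).
exact: (le_bigmax _ (fun v => `|f u - f v|) v).
Qed.

End EdgeAveraging.

(** * Dissipation of the squared deviation at a cubic rate *)

Section EntropyDissipation.
Context {R : realType} {V : finType} {E : {set {set V}}}.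
Hypotheses (simpleE : simple_graph E) (connE : connected_graph E).
Implicit Types (f m : V -> R) (p : seq V).

Let edges_of (u : V) p := pairmap (fun x y => [set x; y]%SET) u p.

Let drop f e := sqdev f - sqdev (edge_avg f e).

Let drop_edge f (u v : V) : [set u; v]%SET \in E ->
  drop f [set u; v]%SET = (f u - f v) ^+ 2 / 2.
Proof.
move=> uvE; rewrite /drop sqdev_edge_avg; first by ring.
by have := simpleE uvE; rewrite cards2; case: eqP.
Qed.

Lemma sqdev_edge_avg_le f e : e \in E -> sqdev (edge_avg f e) <= sqdev f.
Proof.
move=> eE; have /eqP/cards2P[u [v [uv def_e]]] := simpleE eE.
rewrite -subr_ge0 def_e -/(drop f _) drop_edge -?def_e //.
by rewrite divr_ge0 ?sqr_ge0.
Qed.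

Let edges_of_sub u p : path (edge_rel E) u p -> {subset edges_of u p <= E}.
Proof.
elim: p u => [//|y p IH] u /= /andP[uy yp] e; rewrite inE => /orP[/eqP ->//|].
exact: IH.
Qed.

(** Both ends of a later edge lie among the later vertices, where [u] does not recur. Distinctness
    makes the sum along the path a partial sum of the sum over [E]. *)
Let edges_of_uniq u p : uniq (u :: p) -> uniq (edges_of u p).
Proof.
elim: p u => [//|y p IH] u /= /andP[uyp yp]; rewrite IH // andbT.
apply/negP => H; move: uyp; rewrite inE negb_or => /andP[uy up].
have : forall z q, [set u; y]%SET \in edges_of z q -> u \in z :: q.
  move=> z q; elim: q z => [//|t q IHq] z /=; rewrite inE => /orP[/eqP|/IHq].
    move=> /setP/(_ u); rewrite !inE eqxx /= => /esym/orP[/eqP ->|/eqP ->].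
      by rewrite eqxx.
    by rewrite eqxx orbT.
  by rewrite !inE => /orP[->|->]; rewrite !orbT.
by move=> /(_ _ _ H); rewrite inE (negbTE uy) (negbTE up).
Qed.

(* Tangent-line version of Cauchy-Schwarz along the path. *)
Let path_drop f u p (al : R) : path (edge_rel E) u p ->
  al * (f u - f (last u p)) - (size p)%:R * (al ^+ 2 / 2)
    <= \sum_(e <- edges_of u p) drop f e.
Proof.
elim: p u => [|y p IH] u /=; first by rewrite big_nil; lra.
move=> /andP[uy /IH {}IH]; rewrite big_cons drop_edge // -[(size p).+1]addn1 natrD.
have : 0 <= (f u - f y - al) ^+ 2 by apply: sqr_ge0.
lra.
Qed.

Let first_low (low : pred V) u p : low (last u p) -> ~~ low u ->
  exists i, low (last u (take i p)) && all (predC low) (belast u (take i p)).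
Proof.
elim: p u => [|y p IH] u /=; first by move=> ->.
move=> lp lu; have [ly|ly] := boolP (low y).
  by exists 1%N; rewrite /= take0 /= ly lu.
by have [i /andP[H1 H2]] := IH y lp ly; exists i.+1; rewrite /= H1 lu.
Qed.

Let one_sub_exp_half (y : R) : 0 <= y -> Num.min 1 y / 2 <= 1 - expR (- y).
Proof.
move=> y0; have e1 := expR_ge1Dx y.
have -> : expR (- y) = (expR y)^-1 by rewrite expRN.
have iy : (expR y)^-1 <= (1 + y)^-1 by rewrite lef_pV2 // ?posrE ?expR_gt0 //; lra.
apply: le_trans (_ : 1 - (1 + y)^-1 <= _); last by lra.
have -> : 1 - (1 + y)^-1 = y / (1 + y) by field; apply/eqP; lra.
rewrite ler_pdivlMr; last by lra.
rewrite /Num.min; case: ifP => [y1|/negbT]; last by rewrite -leNgt => y1; nra.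
by rewrite mulrDr mulr1; lra.
Qed.

(* A path from a vertex of maximal mass [1/n + x] down to mass [1/n + x/2]
   has at most [2/x] edges, so it carries Dirichlet energy at least [x^3/8],
   and [sqdev m <= x]. *)
Lemma dissipation_rate m (th : R) : prob_vec m -> 0 <= th ->
  Num.min 1 (th * sqdev m ^+ 3) / 32
    <= \sum_(e in E) (1 - expR (- (th * (sqdev m - sqdev (edge_avg m e))))).
Proof.
move=> [m0 m1] th0.
have [v0 _] : exists v0 : V, true.
  apply: contrapT => noV; move: m1; rewrite big1 ?(eq_sym 0).
    by move/eqP; rewrite eq_sym oner_eq0.
  by move=> v _; case: noV; exists v.
have nV : 0 < #|V|%:R :> R by rewrite ltr0n; apply/card_gt0P; exists v0.
pose u := [arg max_(i > v0) m i]%O.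
have um v : m v <= m u by rewrite /u; case: arg_maxP => // i _; apply.
pose a : R := #|V|%:R^-1.
have Sa : \sum_(v : V) a = 1 by rewrite sumr_const -[a *+ _]mulr_natr mulVf // gt_eqF.
pose x := m u - a.
(* In each square, one factor [m v] is bounded by the maximum [m u]; the total mass 1 does the
   rest. *)
have Sx : sqdev m <= x.
  rewrite /sqdev -/a.
  have -> : x = \sum_v (m u * m v - 2 * a * m v + a * a) :> R.
    rewrite big_split /= sumrB -!mulr_sumr m1 Sa /x.
    by lra.
  by apply: ler_sum => v _; have := um v; have := m0 v; nra.
have S0 := sqdev_ge0 m.
have x0 : 0 <= x by apply: le_trans Sx.
have F0 e : e \in E -> 0 <= 1 - expR (- (th * drop m e)).
  move=> eE; rewrite subr_ge0 -(@exp.expR0 R) ler_expR oppr_le0 mulr_ge0 //.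
  by rewrite subr_ge0 sqdev_edge_avg_le.
have [xle0|xgt0] := leP x 0.
  have -> : sqdev m = 0 by apply/eqP; rewrite eq_le S0 andbT (le_trans Sx).
  rewrite expr0n mulr0 (min_idPr _) ?ler01 // mul0r.
  apply: sumr_ge0 => e eE; have := F0 e eE; rewrite /drop; suff -> : sqdev m = 0 by [].
  by apply/eqP; rewrite eq_le S0 andbT (le_trans Sx).
have [w wa] : exists w, m w <= a.
  apply: contrapT => H; have : \sum_(v : V) a < \sum_v m v.
    apply: ltr_sum => [|v _]; first by apply/hasP; exists v0; rewrite ?mem_index_enum.
    by rewrite ltNge; apply/negP => ?; apply: H; exists v.
  by rewrite m1 Sa ltxx.
pose low v := m v <= a + x / 2.
have [p0 p0P def_w] := connectP (connE u w).
move: def_w; case/shortenP: p0P => p pP pU _ def_w.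
have [||i /andP[lowq highq]] := @first_low low u p; rewrite -?def_w.
- by rewrite /low; lra.
- rewrite /low -ltNge /x; move: xgt0; rewrite /x; lra.
set q := take i p in lowq highq.
have qP : path (edge_rel E) u q by apply: take_path.
have qU : uniq (u :: q) by have := take_uniq i.+1 pU.
have sq : (size q)%:R * x <= 2.
  have : (size q)%:R * (x / 2) <= \sum_(v <- belast u q) m v.
    have -> : (size q)%:R * (x / 2) = \sum_(v <- belast u q) (x / 2).
      by rewrite big_const_seq count_predT size_belast iter_addr_0 mulr_natl.
    rewrite !big_seq; apply: ler_sum => v vq.
    have /allP/(_ v vq) /= := highq; rewrite /low -ltNge.
    by move/ltW; apply: le_trans; rewrite lerDr; apply: ltW; rewrite invr_gt0.
  have : \sum_(v <- belast u q) m v <= \sum_v m v.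
    have bU : uniq (belast u q) by move: qU; rewrite lastI rcons_uniq => /andP[].
    rewrite big_uniq //= [leRHS](bigID (mem (belast u q))) /= lerDl.
    by apply: sumr_ge0.
  by rewrite m1; lra.
(* The slope [x ^+ 2 / 4] is the mean decrement of a descent by [x / 2] over [2 / x] edges. It
   yields [x ^+ 3 / 8 - x ^+ 3 / 16]. *)
have dq : x ^+ 3 / 16 <= \sum_(e <- edges_of u q) drop m e.
  apply: le_trans (path_drop m (x ^+ 2 / 4) qP).
  have H1 : x / 2 <= m u - m (last u q) by move: lowq; rewrite /low /x; lra.
  have H2 : x ^+ 2 / 4 * (x / 2) <= x ^+ 2 / 4 * (m u - m (last u q)).
    by rewrite ler_wpM2l // divr_ge0 // sqr_ge0.
  have H3 : (size q)%:R * x * (x ^+ 3 / 32) <= 2 * (x ^+ 3 / 32).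
    by rewrite ler_wpM2r // divr_ge0 // exprn_ge0.
  by move: H2 H3; rewrite !exprS !expr0 !mulr1; lra.
have sub : \sum_(e <- edges_of u q) (1 - expR (- (th * drop m e)))
    <= \sum_(e in E) (1 - expR (- (th * drop m e))).
  rewrite big_uniq /=; last exact: edges_of_uniq.
  rewrite [leRHS](bigID (mem (edges_of u q))) /=.
  rewrite [X in _ <= X + _](eq_bigl (mem (edges_of u q))); last first.
    by move=> e /=; apply/andP/idP => [[]|H] //; split=> //; apply: (@edges_of_sub u q).
  by rewrite lerDl; apply: sumr_ge0 => e /andP[eE _]; apply: F0.
apply: le_trans sub.
(* If [th * drop] is at most 1 on every edge of the path, the exponential gains are linear and the
   drops add up; otherwise a single edge with a large drop already gains 1/2. This saturation is why
   the rate carries a minimum with 1. *)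
have [/allP small|/allPn[e eq]] :=
    boolP (all (fun e => th * drop m e <= 1) (edges_of u q)).
  apply: le_trans (_ : th * (x ^+ 3 / 16) / 2 <= _).
    rewrite ler_pdivrMr // ge_min; apply/orP; right.
    have : th * sqdev m ^+ 3 <= th * x ^+ 3.
      by rewrite ler_wpM2l // lerXn2r // nnegrE.
    by lra.
  apply: le_trans (_ : \sum_(e <- edges_of u q) (th * drop m e / 2) <= _).
    rewrite -mulr_suml -mulr_sumr ler_wpM2r // ler_wpM2l //.
  rewrite !big_seq; apply: ler_sum => e eq.
  move: small => /(_ e eq) small; have ty : 0 <= th * drop m e.
    by rewrite mulr_ge0 // subr_ge0 sqdev_edge_avg_le // (@edges_of_sub u q).
  by have := one_sub_exp_half ty; rewrite (min_idPr small).
rewrite -ltNge => big; rewrite (bigD1_seq e) //=; last exact: edges_of_uniq.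
have eE : e \in E by apply: (@edges_of_sub u q).
rewrite -[leLHS]addr0; apply: lerD.
  have ty : 0 <= th * drop m e by apply: le_trans (ltW big).
  have := one_sub_exp_half ty; rewrite (min_idPl (ltW big)).
  have : Num.min 1 (th * sqdev m ^+ 3) <= 1 by rewrite ge_min lexx.
  by rewrite /drop; lra.
rewrite big_seq_cond; apply: sumr_ge0 => e' /andP[e'q _]; apply: F0.
exact: (@edges_of_sub u q).
Qed.

End EntropyDissipation.

(** * Uniform random words of edges *)

Section Words.
Context {R : realType} {V : finType} (E : {set {set V}}).
Implicit Types (F G : seq {set V} -> R).

Fixpoint words j : seq (seq {set V}) :=
  if j is j'.+1 then [seq e :: s | s <- words j', e <- enum E] else [:: [::]].

(** The expectation of [F] over [j] i.i.d. uniform edges. *)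
Definition wavg j F : R := #|E|%:R^-1 ^+ j * \sum_(s <- words j) F s.

Lemma mem_words j s : (s \in words j) = (size s == j) && all (mem E) s.
Proof.
elim: j s => [|j IH] s /=; first by rewrite inE; case: s.
apply/allpairsP/andP => [[[s' e] /= [+ + ->]]|[+ +]].
  by rewrite IH mem_enum => /andP[/eqP <- sE] eE /=; rewrite eE sE eqxx.
case: s => [//|e s] /= sj /andP[eE sE]; exists (s, e) => /=.
by rewrite IH sE mem_enum eE andbT -eqSS.
Qed.

Lemma words_uniq j : uniq (words j).
Proof.
elim: j => [//|j IH] /=; apply: allpairs_uniq => //; first exact: enum_uniq.
by move=> [s e] [s' e'] _ _ /= [-> ->].
Qed.

Lemma wavg0 F : wavg 0 F = F [::].
Proof. by rewrite /wavg /= expr0 mul1r big_seq1. Qed.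

Lemma wavgS j F :
  wavg j.+1 F = wavg j (fun s => #|E|%:R^-1 * \sum_(e in E) F (e :: s)).
Proof.
rewrite /wavg /= big_allpairs_dep exprSr -mulrA; congr (_ * _).
by rewrite mulr_sumr; apply: eq_bigr => s _; rewrite big_enum.
Qed.

Lemma eq_wavg j F G : F =1 G -> wavg j F = wavg j G.
Proof. by move=> FG; rewrite /wavg; congr (_ * _); apply: eq_bigr => s _. Qed.

Lemma wavgZ j c F : wavg j (fun s => c * F s) = c * wavg j F.
Proof. by rewrite /wavg -mulr_sumr mulrCA. Qed.

Lemma wavg_sum j (I : Type) (r : seq I) (P : pred I)
    (F : I -> seq {set V} -> R) :
  wavg j (fun s => \sum_(i <- r | P i) F i s) = \sum_(i <- r | P i) wavg j (F i).
Proof. by rewrite /wavg exchange_big mulr_sumr. Qed.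

Lemma wavg_le j F G : (forall s, s \in words j -> F s <= G s) ->
  wavg j F <= wavg j G.
Proof.
move=> FG; rewrite /wavg ler_wpM2l ?exprn_ge0 ?invr_ge0 //.
by rewrite !big_seq; apply: ler_sum.
Qed.

Lemma wavgS_rcons j F :
  wavg j.+1 F = #|E|%:R^-1 * \sum_(e in E) wavg j (fun s => F (rcons s e)).
Proof.
elim: j F => [|j IH] F.
  by rewrite wavgS wavg0; congr (_ * _); apply: eq_bigr => e _; rewrite wavg0.
rewrite wavgS IH; congr (_ * _); apply: eq_bigr => e _.
by rewrite wavgS.
Qed.

Lemma wavg_rev j F : wavg j F = wavg j (fun s => F (rev s)).
Proof.
elim: j F => [|j IH] F; first by rewrite !wavg0.
rewrite wavgS_rcons wavgS wavgZ; congr (_ * _).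
rewrite wavg_sum; apply: eq_bigr => e _.
by rewrite IH; apply: eq_wavg => s; rewrite rev_cons.
Qed.

Lemma wavg1 j : (0 < #|E|)%N -> wavg j (fun=> 1) = 1.
Proof.
move=> d0; elim: j => [|j IH]; first by rewrite wavg0.
rewrite wavgS -[RHS]IH; apply: eq_wavg => s.
by rewrite sumr_const -[1 *+ _]mulr_natl mulr1 mulVf // pnatr_eq0 -lt0n.
Qed.

End Words.

(** * Exponential moments of the squared deviation *)

Section ExponentialMoment.
Context {R : realType} {V : finType} {E : {set {set V}}}.
Hypotheses (simpleE : simple_graph E) (connE : connected_graph E).
Hypothesis E_gt0 : (0 < #|E|)%N.
Implicit Types (m : V -> R) (a : R).

Let d : R := #|E|%:R.

Let d_gt0 : 0 < d. Proof. by rewrite ltr0n. Qed.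

Lemma sqdev_le1 m : prob_vec m -> sqdev m <= 1.
Proof.
move=> [m0 m1]; rewrite /sqdev; set c := _^-1.
have c0 : 0 <= c by rewrite invr_ge0.
have m_le1 v : m v <= 1.
  by rewrite -m1 (bigD1 v) //= lerDl sumr_ge0.
have Sc : \sum_(v : V) c <= 1.
  rewrite sumr_const -[c *+ _]mulr_natr /c.
  by have [->|n0] := eqVneq (#|V|%:R : R) 0; rewrite ?mulr0 ?ler01 ?mulVf.
have : \sum_v (m v - c) ^+ 2 <= \sum_v ((1 - 2 * c) * m v + c * c).
  by apply: ler_sum => v _; have := m0 v; have := m_le1 v; nra.
rewrite big_split /= -!mulr_sumr m1; nra.
Qed.

(* The tangent line at [y] of the cubic dissipation rate absorbs the linear
   term [a * sqdev m] created by raising the exponent from [th] to [th + a/d]. *)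
Let one_step m a (th y : R) : prob_vec m -> 0 <= a <= 1 / 32 -> 0 <= th -> 0 <= y ->
    (th + a / d) * y ^+ 2 = 32 * a ->
  d^-1 * \sum_(e in E) expR ((th + a / d) * sqdev (edge_avg m e))
    <= expR (th * sqdev m + a * y / d).
Proof.
move=> pm /andP[a0 a1] th0 y0; set th' := th + a / d => thy.
have th'0 : 0 <= th' by rewrite addr_ge0 // divr_ge0 // ltW.
have S0 := sqdev_ge0 m; have S1 := sqdev_le1 pm.
set S := sqdev m in S0 S1 *.
have rate := dissipation_rate simpleE connE pm th'0; rewrite -/S in rate.
set M := Num.min _ _ in rate.
have -> : \sum_(e in E) expR (th' * sqdev (edge_avg m e)) =
    expR (th' * S) * (d - \sum_(e in E) (1 - expR (- (th' * (S - sqdev (edge_avg m e)))))).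
  rewrite sumrB sumr_const opprB addrCA subrr addr0 mulr_sumr.
  by apply: eq_bigr => e _; rewrite -exp.expRD; congr expR; ring.
rewrite mulrCA mulrBr mulVf ?gt_eqF //.
apply: le_trans (_ : expR (th' * S) * expR (- (d^-1 * (M / 32))) <= _).
  rewrite ler_wpM2l ?expR_ge0 //; apply: le_trans (expR_ge1Dx _).
  by rewrite lerD2l lerN2 ler_wpM2l // invr_ge0 ltW.
rewrite -exp.expRD ler_expR.
suff : a * S <= a * y + M / 32.
  move=> H; have : d^-1 * (a * S) <= d^-1 * (a * y + M / 32).
    by rewrite ler_wpM2l // invr_ge0 ltW.
  by rewrite /th' mulrDl; lra.
(* When the rate is saturated, [a * S <= a <= 1 / 32] because [S <= 1]; this is the origin of the
   bound on [a]. Otherwise only [S > y] matters, where [th' * S ^+ 3 >= th' * y ^+ 2 * S = 32 * a *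
   S]. *)
rewrite /M /Num.min; case: ifP => _.
  have : a * S <= a by rewrite -[leRHS]mulr1 ler_wpM2l.
  have : 0 <= a * y by rewrite mulr_ge0.
  lra.
have [Sy|/ltW yS] := leP S y.
  have : a * S <= a * y by rewrite ler_wpM2l.
  have : 0 <= th' * S ^+ 3 by rewrite mulr_ge0 // exprn_ge0.
  lra.
have : th' * y ^+ 2 * S <= th' * S ^+ 3.
  rewrite -mulrA ler_wpM2l // [S ^+ 3]exprSr ler_wpM2r // lerXn2r // nnegrE //.
rewrite thy.
have : 0 <= a * y by rewrite mulr_ge0.
lra.
Qed.

(** The choice [y = 32 / Y] meets the constraint of [one_step]. Since [32 / d = Y ^+ 2 - X ^+ 2],
    each correction [a * y / d] is at most [2 * a * (Y - X)], so the corrections telescope to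
    [2 * a * Y]. *)
Lemma exp_moment_sqdev m a j : prob_vec m -> 0 <= a <= 1 / 32 ->
  wavg E j (fun s => expR (a * (j%:R / d) * sqdev (act s m)))
    <= expR (2 * a * Num.sqrt (32 * (j%:R / d))).
Proof.
move=> pm a01; have a0 : 0 <= a by case/andP: a01.
elim: j => [|j IH]; first by rewrite wavg0 !mul0r !mulr0 sqrtr0 !mulr0 mul0r.
rewrite wavgS.
set X := Num.sqrt (32 * (j%:R / d)) in IH *.
set Y := Num.sqrt _.
have Y2 : Y ^+ 2 = 32 * (j.+1%:R / d).
  by rewrite sqr_sqrtr // mulr_ge0 // divr_ge0 // ltW.
have X2 : X ^+ 2 = 32 * (j%:R / d).
  by rewrite sqr_sqrtr // mulr_ge0 // divr_ge0 // ltW.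
have Y0 : 0 < Y.
  by rewrite sqrtr_gt0 mulr_gt0 // divr_gt0 // ltr0n.
have X0 : 0 <= X by apply: sqrtr_ge0.
have jS : (j.+1%:R : R) = j%:R + 1 by rewrite -addn1 natrD.
apply: le_trans (_ : wavg E j (fun s => expR (a * (32 / Y) / d) *
    expR (a * (j%:R / d) * sqdev (act s m))) <= _).
  apply: wavg_le => s _.
  rewrite -exp.expRD [leRHS](_ : _ =
      expR (a * (j%:R / d) * sqdev (act s m) + a * (32 / Y) / d)); last first.
    by congr expR; rewrite addrC.
  have -> : a * (j.+1%:R / d) = a * (j%:R / d) + a / d by rewrite jS; ring.
  apply: one_step => //.
  - exact: act_prob_vec.
  - by rewrite mulr_ge0 // divr_ge0 // ltW.
  - by rewrite divr_ge0 // ltW.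
  rewrite expr_div_n Y2 jS; field.
  by rewrite -natr1 in jS; rewrite gt_eqF //= natr1 pnatr_eq0.
rewrite wavgZ; apply: le_trans (_ : expR (a * (32 / Y) / d) * expR (2 * a * X) <= _).
  by rewrite ler_wpM2l // expR_ge0.
rewrite -exp.expRD ler_expR.
have -> : a * (32 / Y) / d + 2 * a * X = a * (32 / d / Y + 2 * X).
  by field; rewrite !gt_eqF.
rewrite [leRHS](_ : _ = a * (2 * Y)); last by ring.
rewrite ler_wpM2l //.
have -> : 32 / d = Y ^+ 2 - X ^+ 2 by rewrite Y2 X2 jS; ring.
have -> : (Y ^+ 2 - X ^+ 2) / Y + 2 * X = (Y ^+ 2 - X ^+ 2 + 2 * X * Y) / Y.
  by field; rewrite gt_eqF.
rewrite ler_pdivrMr //.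
have := sqr_ge0 (Y - X); lra.
Qed.

End ExponentialMoment.

(** * A Hoeffding bound for weighted sums of i.i.d. bounded variables *)

Section Hoeffding.
Context {R : realType} {I V : finType} (p a : I -> R).
Hypotheses (p_ge0 : forall i, 0 <= p i) (p_sum1 : \sum_i p i = 1).
Hypothesis a_le1 : forall i, `|a i| <= 1.

(** The linear term vanishes on averaging a centred variable, which leaves a Gaussian bound. For
    [z >= 1/4] already [z <= 4 * z ^+ 2]; below, [expR z <= 1 / (1 - z)]. *)
Lemma expR_le_linear_gauss (z : R) : expR z <= z + expR (4 * z ^+ 2).
Proof.
have g1 := expR_ge1Dx (4 * z ^+ 2); have z2 := sqr_ge0 z.
have [z4|z4] := leP (1 / 4) z.
  apply: le_trans (_ : expR (4 * z ^+ 2) <= _); last by lra.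
  by rewrite ler_expR expr2; nra.
have e1 : expR z <= (1 - z)^-1.
  rewrite -[z in leLHS]opprK expRN lef_pV2 ?posrE ?expR_gt0 //; last by lra.
  by have := expR_ge1Dx (- z); lra.
apply: le_trans e1 _; rewrite -[_^-1]mul1r ler_pdivrMr; last by lra.
apply: le_trans (_ : (z + (1 + 4 * z ^+ 2)) * (1 - z) <= _).
  by rewrite expr2; nra.
by rewrite ler_wpM2r; lra.
Qed.

Let mu : R := \sum_i p i * a i.

Let mu_le1 : `|mu| <= 1.
Proof.
apply: le_trans (ler_norm_sum _ _ _) _; rewrite -[leRHS]p_sum1.
apply: ler_sum => i _; rewrite normrM (ger0_norm (p_ge0 i)).
by rewrite -[leRHS]mulr1 ler_wpM2l.
Qed.

Let mgf_centered (y : R) :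
  \sum_i p i * expR (y * (a i - mu)) <= expR (16 * y ^+ 2).
Proof.
apply: le_trans (_ : \sum_i (y * (p i * a i - mu * p i) + p i * expR (16 * y ^+ 2)) <= _).
  apply: ler_sum => i _.
  have := expR_le_linear_gauss (y * (a i - mu)).
  have : expR (4 * (y * (a i - mu)) ^+ 2) <= expR (16 * y ^+ 2).
    rewrite ler_expR exprMn.
    have : (a i - mu) ^+ 2 <= 4.
      have := a_le1 i; have := mu_le1; rewrite !ler_norml => /andP[? ?] /andP[? ?].
      by rewrite expr2; nra.
    by have := sqr_ge0 y; nra.
  by have := p_ge0 i; nra.
rewrite big_split /= -mulr_sumr -mulr_suml sumrB -mulr_sumr p_sum1 -/mu.
by rewrite mulr1 subrr mulr0 add0r mul1r.
Qed.

(** Weights of sum 0 allow the mean to be subtracted from every value, and independence is the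
    distributivity of product over sum. The constant is [4 * 2 ^+ 2], a centred value being at most
    2 in modulus. *)
Lemma mgf_iid (w : V -> R) (lam : R) : \sum_v w v = 0 ->
  \sum_(g : {ffun V -> I}) (\prod_v p (g v)) * expR (lam * \sum_v w v * a (g v))
    <= expR (16 * lam ^+ 2 * \sum_v w v ^+ 2).
Proof.
move=> w0.
under eq_bigr => g _.
  have -> : lam * \sum_v w v * a (g v) = \sum_v lam * w v * (a (g v) - mu).
    under [RHS]eq_bigr do rewrite mulrBr -mulrA.
    by rewrite sumrB -mulr_suml -!mulr_sumr w0 mulr0 mul0r subr0.
  rewrite expR_sum -big_split /=.
  over.
rewrite -(bigA_distr_bigA (fun v i => p i * expR (lam * w v * (a i - mu)))) /=.
rewrite mulr_sumr expR_sum; apply: ler_prod => v _; apply/andP; split.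
  by apply: sumr_ge0 => i _; rewrite mulr_ge0 // expR_ge0.
by rewrite -mulrA -exprMn mgf_centered.
Qed.

End Hoeffding.

(** * Probability of disagreement after [j] uniform rings *)

Section DisagreementProbability.
Context {R : realType} {I V : finType} (E : {set {set V}}) (p a : I -> R).
Hypotheses (simpleE : simple_graph E) (connE : connected_graph E).
Hypothesis E_gt0 : (0 < #|E|)%N.
Hypotheses (p_ge0 : forall i, 0 <= p i) (p_sum1 : \sum_i p i = 1).
Hypothesis a_le1 : forall i, `|a i| <= 1.

(** The initial opinion of [v] is [a (g v)], the indices [g v] being i.i.d. with law [p]; the edge
    word is uniform and independent of them. *)
Definition disagree_prob j (eps : R) : R := wavg E j (fun s =>
  \sum_(g : {ffun V -> I}) (\prod_v p (g v)) * (eps < osc (act s (a \o g)))%R%:R).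

Let d : R := #|E|%:R.

Let d_gt0 : 0 < d. Proof. by rewrite ltr0n. Qed.

Let delta (v : V) : V -> R := fun u => (u == v)%:R.

Let delta_prob v : prob_vec (delta v).
Proof.
split=> [u|]; first by rewrite ler0n.
rewrite (bigD1 v) //= big1 ?addr0 ?/delta ?eqxx //.
by move=> u /negbTE uv; rewrite uv.
Qed.

(** Row [v] of the matrix of [act s] minus the uniform row. Its entries sum to 0 and its sum of
    squares is the [sqdev] of the transported unit mass. *)
Let row s v : V -> R := fun u => act (rev s) (delta v) u - #|V|%:R^-1.

Let row_sum s v : \sum_u row s v u = 0.
Proof.
rewrite sumrB act_sum; have [_ ->] := delta_prob v.
rewrite sumr_const -[(_^-1) *+ _]mulr_natr mulVf ?subrr //.
by rewrite pnatr_eq0 -lt0n; apply/card_gt0P; exists v.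
Qed.

Let rowE s v (f : V -> R) :
  \sum_u row s v u * f u = act s f v - (\sum_u f u) / #|V|%:R.
Proof.
under eq_bigr do rewrite mulrBl.
rewrite sumrB act_dual revK -mulr_sumr mulrC; congr (_ - _).
rewrite (bigD1 v) //= big1 ?addr0 /delta ?eqxx ?mul1r //.
by move=> u /negbTE ->; rewrite mul0r.
Qed.

Let pi g : R := \prod_(v : V) p (g v).

Let pi_ge0 (g : {ffun V -> I}) : 0 <= pi g. Proof. exact: prodr_ge0. Qed.

Let pi_sum1 : \sum_(g : {ffun V -> I}) pi g = 1.
Proof. by rewrite -(bigA_distr_bigA (fun _ i => p i)) /= p_sum1 big1. Qed.

Lemma disagree_prob_ge0 j eps : 0 <= disagree_prob j eps.
Proof.
rewrite mulr_ge0 ?exprn_ge0 ?invr_ge0 //; apply: sumr_ge0 => s _.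
by apply: sumr_ge0 => g _; rewrite mulr_ge0 ?pi_ge0.
Qed.

Lemma disagree_prob_le1 j eps : disagree_prob j eps <= 1.
Proof.
rewrite -(@wavg1 R V E j E_gt0); apply: wavg_le => s _; rewrite -[leRHS]pi_sum1.
by apply: ler_sum => g _; rewrite -/(pi g) ler_piMr ?pi_ge0 //; case: ltP.
Qed.

Lemma disagree_prob_large j (eps : R) : 2 <= eps -> disagree_prob j eps = 0.
Proof.
move=> e2; rewrite /disagree_prob /wavg big1 ?mulr0 // => s _.
rewrite big1 // => g _; rewrite ltNge (le_trans _ e2) ?mulr0 //.
apply: osc_le => // u v.
have H w : `|act s (a \o g) w| <= 1.
  have := @act_dist_le R V s (a \o g) (fun=> 0) 1; rewrite act_cst => /(_ _ w).
  by rewrite subr0; apply=> x; rewrite subr0 /= a_le1.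
by apply: le_trans (ler_normB _ _) _; have := H u; have := H v; lra.
Qed.

(* Chernoff: an oscillation above [eps] forces some vertex at distance more
   than [eps/2] from the mean. *)
Let osc_chernoff (f : V -> R) (mean lam eps : R) : 0 <= lam -> 0 <= eps ->
  (eps < osc f)%R%:R <= \sum_v expR (- (lam * eps / 2)) *
     (expR (lam * (f v - mean)) + expR (- lam * (f v - mean))).
Proof.
move=> l0 e0.
have P0 v : 0 <= expR (- (lam * eps / 2)) *
     (expR (lam * (f v - mean)) + expR (- lam * (f v - mean))).
  by rewrite mulr_ge0 ?addr_ge0 ?expR_ge0.
have [/osc_gtP|_] := ltP; last by apply: sumr_ge0.
move=> /(_ e0)[u [v uv]].
have [w Hw] : exists w, eps / 2 <= `|f w - mean|.
  have [?|H1] := leP (eps / 2) `|f u - mean|; first by exists u.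
  exists v; have : `|f u - f v| <= `|f u - mean| + `|f v - mean|.
    by apply: le_trans (ler_normB _ _); rewrite opprB addrA subrK.
  lra.
rewrite (bigD1 w) //= -[leLHS]addr0 lerD ?sumr_ge0 //.
rewrite mulrDr -!exp.expRD.
have one (x : R) : 0 <= x -> 1 <= expR x by move=> x0; have := expR_ge1Dx x; lra.
have e1 := expR_ge0 (- (lam * eps / 2) + lam * (f w - mean)).
have e2 := expR_ge0 (- (lam * eps / 2) + - lam * (f w - mean)).
move: Hw; rewrite ler_normr => /orP[] Hw.
  have H : lam * (eps / 2) <= lam * (f w - mean) by rewrite ler_wpM2l.
  by have := one (- (lam * eps / 2) + lam * (f w - mean)); lra.
have H : lam * (eps / 2) <= lam * (- (f w - mean)) by rewrite ler_wpM2l.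
by have := one (- (lam * eps / 2) + - lam * (f w - mean)); lra.
Qed.

Lemma disagree_prob_le j (eps : R) : 0 < eps ->
  disagree_prob j eps
    <= 2 * #|V|%:R * expR (- (2 * (eps / 96) ^+ 2 * Num.sqrt (j%:R / d))).
Proof.
move=> eps0; have [e2|eps2] := leP 2 eps.
  by rewrite disagree_prob_large // mulr_ge0 ?expR_ge0.
set sT := Num.sqrt _; have sT0 : 0 <= sT by apply: sqrtr_ge0.
have T0 : 0 <= j%:R / d by rewrite divr_ge0 // ltW.
have sT2 : sT ^+ 2 = j%:R / d by rewrite sqr_sqrtr.
(* The choice [16 * lam ^+ 2 = al * (j / d)] identifies Hoeffding's exponent with that of the
   exponential moment. The Chernoff gain [lam * eps / 2] is then [3/2 * k ^+ 2 * sT], while the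
   moment costs at most [3/4 * k ^+ 2 * sT] since [sqrt 32 <= 6]; of the difference,
   [k ^+ 2 * sT / 2] is kept. *)
pose k := eps / 48; pose lam := k * sT / 16; pose al := k ^+ 2 / 16.
have k0 : 0 <= k by rewrite divr_ge0 // ltW.
have k1 : k <= 1 / 16 by rewrite /k; lra.
have lam0 : 0 <= lam by rewrite divr_ge0 // mulr_ge0.
have lam2 : 16 * lam ^+ 2 = al * (j%:R / d).
  by rewrite -sT2 /lam /al; field.
have al01 : 0 <= al <= 1 / 32.
  by apply/andP; split; rewrite /al expr2; nra.
pose ex (g : {ffun V -> I}) s v (la : R) :=
  expR (la * \sum_u row s v u * a (g u)).
apply: le_trans (_ : wavg E j (fun s => \sum_(g : {ffun V -> I}) pi g *
    \sum_v expR (- (lam * eps / 2)) * (ex g s v lam + ex g s v (- lam))) <= _).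
  apply: wavg_le => s _; apply: ler_sum => g _; rewrite ler_wpM2l ?pi_ge0 //.
  apply: le_trans (osc_chernoff _ (\sum_u a (g u) / #|V|%:R) lam0 (ltW eps0)) _.
  by apply: ler_sum => v _; rewrite /ex !(rowE s v (a \o g)) -mulr_suml.
apply: le_trans (_ : wavg E j (fun s => \sum_v (2 * expR (- (lam * eps / 2)) *
    expR (al * (j%:R / d) * sqdev (act (rev s) (delta v))))) <= _).
  apply: wavg_le => s _.
  under eq_bigr do rewrite mulr_sumr.
  rewrite exchange_big /=; apply: ler_sum => v _.
  have mgf la : la ^+ 2 = lam ^+ 2 -> \sum_(g : {ffun V -> I}) pi g * ex g s v la
      <= expR (al * (j%:R / d) * sqdev (act (rev s) (delta v))).
    move=> la2; apply: le_trans (mgf_iid p_ge0 p_sum1 a_le1 _ (row_sum s v)) _.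
    by rewrite la2 lam2.
  under eq_bigr do rewrite mulrCA mulrDr.
  rewrite -mulr_sumr big_split /= [in leRHS]mulrAC [leRHS]mulrC ler_wpM2l ?expR_ge0 //.
  have := mgf lam erefl; have := mgf (- lam) (sqrrN _); lra.
rewrite wavg_sum; apply: le_trans (_ : \sum_(v : V) 2 * expR (- (lam * eps / 2)) *
    expR (2 * al * Num.sqrt (32 * (j%:R / d))) <= _).
  apply: ler_sum => v _; rewrite wavgZ ler_wpM2l ?mulr_ge0 ?expR_ge0 //.
  rewrite wavg_rev; under eq_wavg do rewrite revK.
  exact: exp_moment_sqdev.
rewrite sumr_const -[(_ * _) *+ _]mulr_natl.
set e1 := expR (- _); set e2 := expR (2 * al * _).
have -> : #|V|%:R * (2 * e1 * e2) = 2 * #|V|%:R * (e1 * e2) by ring.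
rewrite ler_wpM2l ?mulr_ge0 // /e1 /e2 -exp.expRD ler_expR.
have s6 : Num.sqrt (32 * (j%:R / d)) <= 6 * sT.
  rewrite sqrtrM // ler_wpM2r //.
  have six : (0 : R) <= 6 by [].
  by rewrite -(ger0_norm six) -sqrtr_sqr ler_wsqrtr // -natrX ler_nat.
have : 2 * al * Num.sqrt (32 * (j%:R / d)) <= 2 * al * (6 * sT).
  by rewrite ler_wpM2l // mulr_ge0 //; case/andP: al01.
have -> : eps = 48 * k by rewrite /k; field.
have : 0 <= k ^+ 2 * sT by rewrite mulr_ge0 // sqr_ge0.
have -> : 48 * k / 96 = k / 2 by field.
rewrite /lam /al !expr2; lra.
Qed.

End DisagreementProbability.

(** * Summing the tail over the number of rings *)

Section Summation.
Context {R : realType}.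

Lemma expR_ge_pow4 (y : R) : 0 <= y -> (y / 4) ^+ 4 <= expR y.
Proof.
move=> y0; have -> : expR y = expR (y / 4) ^+ 4.
  by rewrite -expRM_natl; congr expR; field.
rewrite lerXn2r ?nnegrE ?expR_ge0 //; first by lra.
by have := expR_ge1Dx (y / 4); lra.
Qed.

(** Each term is at most a decrement of [6 * B ^+ 2 / (j + B)], so the sum telescopes below the
    initial value [6 * B]. The factor 6 comes from [(j + B) * (j + 1 + B)], which is at most
    [6 * B ^+ 2] for [j < B] and [6 * j ^+ 2] for [j >= B], as [B >= 1]. *)
Lemma sum_le_inverse_square_tail (Q : nat -> R) (B : R) N : 1 <= B ->
  (forall j, Q j <= 1) ->
  (forall j, B <= j%:R -> Q j <= (B / j%:R) ^+ 2) ->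
  \sum_(j < N) Q j <= 6 * B.
Proof.
move=> B1 Q1 Q2.
pose u j : R := 6 * B ^+ 2 / (j%:R + B).
have B0 : 0 < B by lra.
have jB j : 0 < j%:R + B by rewrite ltr_wpDl.
have Qu j : Q j <= u j - u j.+1.
  have j0 : (0 : R) <= j%:R by [].
  have -> : u j - u j.+1 = 6 * B ^+ 2 / ((j%:R + B) * (j.+1%:R + B)).
    have := jB j; have := jB j.+1; rewrite /u -natr1 => ? ?.
    by field; rewrite !gt_eqF.
  have P0 : 0 < (j%:R + B) * (j.+1%:R + B) by rewrite mulr_gt0.
  rewrite ler_pdivlMr //.
  have [jB1|jB1] := ltP j%:R B.
    apply: le_trans (_ : 1 * ((j%:R + B) * (j.+1%:R + B)) <= _).
      by rewrite ler_wpM2r // ltW.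
    by rewrite -natr1 expr2; nra.
  have j1 : 0 < (j%:R : R) by lra.
  apply: le_trans (_ : (B / j%:R) ^+ 2 * (6 * j%:R ^+ 2) <= _).
    apply: le_trans (_ : (B / j%:R) ^+ 2 * ((j%:R + B) * (j.+1%:R + B)) <= _).
      by rewrite ler_wpM2r ?Q2 // ltW.
    by rewrite ler_wpM2l ?sqr_ge0 // -natr1 expr2; nra.
  by rewrite le_eqVlt; apply/orP; left; apply/eqP; field; rewrite gt_eqF.
apply: le_trans (_ : u 0%N - u N <= _).
  elim: N => [|N IH]; first by rewrite big_ord0 subrr.
  by rewrite big_ord_recr /=; have := Qu N; lra.
have : 0 <= u N by rewrite /u divr_ge0 ?mulr_ge0 ?exprn_ge0 // ltW.
have -> : u 0%N = 6 * B by rewrite /u add0r; field; rewrite gt_eqF.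
lra.
Qed.

End Summation.

(** * The bound of order [log^2 n / eps^4] on the summed probabilities *)

Section TotalDisagreement.
Context {R : realType} {I V : finType} (E : {set {set V}}) (p a : I -> R).
Hypotheses (simpleE : simple_graph E) (connE : connected_graph E).
Hypotheses (E_gt0 : (0 < #|E|)%N) (V_gt1 : (1 < #|V|)%N).
Hypotheses (p_ge0 : forall i, 0 <= p i) (p_sum1 : \sum_i p i = 1).
Hypothesis a_le1 : forall i, `|a i| <= 1.

Lemma sum_disagree_prob_le (eps : R) N : 0 < eps ->
  #|E|%:R^-1 * \sum_(j < N) disagree_prob E p a j eps
    <= 6 * (8 * ln #|V|%:R) ^+ 2 * (96 / eps) ^+ 4.
Proof.
move=> eps0; have [e2|e2] := leP 2 eps.
  rewrite big1 ?mulr0.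
    apply: mulr_ge0; first by apply: mulr_ge0 => //; apply: sqr_ge0.
    by apply: exprn_ge0; apply: divr_ge0 => //; apply: ltW.
  by move=> j _; apply: disagree_prob_large.
pose d : R := #|E|%:R; pose n : R := #|V|%:R.
have d1 : 1 <= d by rewrite ler1n.
have n2 : 2 <= n by rewrite ler_nat.
pose L := ln (2 * n); pose q := (eps / 96) ^+ 2.
have expL : expR L = 2 * n by rewrite /L lnK // posrE; lra.
have L1 : 1 <= L.
  rewrite -ler_expR expL; apply: le_trans (_ : 4 <= _); last by lra.
  have -> : expR 1 = (expR (- (1 / 2)) ^+ 2)^-1 :> R.
    by rewrite -expRM_natl -expRN; congr expR; field.
  rewrite invf_ple ?posrE ?exprn_gt0 ?expR_gt0 // expr2.
  have := expR_ge1Dx (- (1 / 2) : R); nra.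
have Ln : L <= 2 * ln n.
  have n0 : 0 < n by lra.
  rewrite /L lnM ?posrE //.
  have : ln 2 <= ln n by rewrite ler_ln // posrE; lra.
  lra.
have q0 : 0 < q by rewrite exprn_gt0 // divr_gt0.
have q1 : q <= 1 by rewrite /q expr2; nra.
(* Beyond [B] steps [q * r >= L], so half of the exponent [2 * q * r] absorbs the prefactor
   [2 * n = expR L]. The other half is at most [(4 / (q * r)) ^+ 4], a fourth power because [r] is a
   square root: it becomes [(16 * d / (q ^+ 2 * j)) ^+ 2], which is below [(B / j) ^+ 2]. *)
pose B := 16 * (d * (L / q) ^+ 2).
have Lq1 : 1 <= L / q by rewrite ler_pdivlMr //; lra.
have B1 : 1 <= B.
  have Lq2 : 1 <= (L / q) ^+ 2 by rewrite exprn_ege1.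
  by rewrite /B; nra.
have H := @sum_le_inverse_square_tail R (fun j => disagree_prob E p a j eps) B N B1.
apply: le_trans (_ : d^-1 * (6 * B) <= _).
  rewrite ler_wpM2l ?invr_ge0 //.
  apply: H => [j|j Bj]; first exact: disagree_prob_le1.
  apply: le_trans (disagree_prob_le simpleE connE E_gt0 p_ge0 p_sum1 a_le1 j eps0) _.
  rewrite -/n -/d -/q -expL -exp.expRD; set r := Num.sqrt _.
  have r0 : 0 <= r by apply: sqrtr_ge0.
  have r2 : r ^+ 2 = j%:R / d by rewrite sqr_sqrtr // divr_ge0 //; lra.
  have Lqr : L <= q * r.
    rewrite -ler_pdivrMl // mulrC -(@ler_pXn2r _ 2) ?nnegrE //; last by lra.
    rewrite r2 ler_pdivlMr ?(lt_le_trans ltr01) //.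
    have Z0 : 0 <= d * (L / q) ^+ 2 by rewrite mulr_ge0 // sqr_ge0.
    apply: le_trans Bj; rewrite /B.
    rewrite [_ * d]mulrC.
    by move: Z0; move: (d * _) => Z Z0; lra.
  apply: le_trans (_ : expR (- (q * r)) <= _).
    by rewrite ler_expR -mulrA; move: Lqr; move: (q * r) => Z; lra.
  have qr0 : 0 < q * r by apply: lt_le_trans Lqr; lra.
  have qr4 := expR_ge_pow4 (ltW qr0).
  rewrite expRN; apply: le_trans (_ : ((q * r / 4) ^+ 4)^-1 <= _).
    by rewrite lef_pV2 // ?posrE ?expR_gt0 // exprn_gt0 // divr_gt0.
  have j0 : 0 < j%:R :> R by lra.
  have -> : ((q * r / 4) ^+ 4)^-1 = (16 * d / (q ^+ 2 * j%:R)) ^+ 2.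
    have -> : (q * r / 4) ^+ 4 = (q ^+ 2 * (r ^+ 2) / 16) ^+ 2 by field.
    rewrite r2; field.
    by rewrite !gt_eqF //; lra.
  have -> : B / j%:R = 16 * d / (q ^+ 2 * j%:R) * L ^+ 2.
    by rewrite /B; field; rewrite !gt_eqF.
  have X0 : 0 <= 16 * d / (q ^+ 2 * j%:R).
    by rewrite divr_ge0 // mulr_ge0 // ?exprn_ge0 //; lra.
  have L2 : 1 <= L ^+ 2 by rewrite expr2; nra.
  have L0 := le_trans ler01 L2.
  apply: lerXn2r; rewrite ?nnegrE //; first exact: mulr_ge0.
  by rewrite ler_peMr.
have -> : d^-1 * (6 * B) = 6 * (4 * L) ^+ 2 / q ^+ 2.
  by rewrite /B; field; rewrite !gt_eqF //; lra.
have -> : 6 * (4 * L) ^+ 2 / q ^+ 2 = 6 * (4 * L) ^+ 2 * (96 / eps) ^+ 4.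
  have -> : q ^+ 2 = ((96 / eps) ^+ 4)^-1.
    by rewrite /q -exprM -exprVn invf_div.
  by rewrite invrK.
rewrite ler_wpM2r ?exprn_ge0 ?divr_ge0 //; first by lra.
have : L ^+ 2 <= (2 * ln n) ^+ 2 by rewrite lerXn2r // nnegrE; lra.
rewrite !exprMn -/n !expr2; lra.
Qed.

End TotalDisagreement.

(** * Measurability of countable conditions, and passages to the limit *)

Section Measurability.
Context {d : measure_display} {T : measurableType d} {R : realType}.

Lemma measurable_gt (f : T -> R) (x : R) : measurable_fun setT f ->
  measurable [set w | x < f w].
Proof.
move=> mf; rewrite [X in measurable X](_ : _ = setT `&` f @^-1` `]x, +oo[%classic).
  by apply: mf => //; apply: measurable_itv.
by apply/seteqP; split => w /=; rewrite in_itv /= andbT; [split|case].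
Qed.

Lemma measurable_forall (K : countType) (D : K -> Prop) (Q : K -> set T) :
  (forall k, D k -> measurable (Q k)) ->
  measurable [set w | forall k, D k -> Q k w].
Proof.
move=> mQ.
rewrite [X in measurable X](_ : _ =
    \bigcap_n (if unpickle n is Some k then [set w | D k -> Q k w] else setT)).
  apply: bigcapT_measurable => n; case: unpickle => [k|]; last exact: measurableT.
  have [Dk|Dk] := pselect (D k).
    rewrite [X in measurable X](_ : _ = Q k); first exact: mQ.
    by apply/seteqP; split => w /= H; [apply: H|].
  rewrite [X in measurable X](_ : _ = setT); first exact: measurableT.
  by apply/seteqP; split => w /=.
apply/seteqP; split => w H.
  by move=> n _; case: unpickle => [k|//]; exact: (H k).
by move=> k; have := H (pickle k) I; rewrite pickleK.
Qed.

End Measurability.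

Section Limits.
Context {R : realType}.
Implicit Types a b c r : R.

Lemma le_of_le_add_small a b c :
  (forall h : R, 0 < h < 1 -> a <= b + c * h) -> a <= b.
Proof.
move=> H; rewrite leNgt; apply/negP => ba.
pose D := a - b; have D0 : 0 < D by rewrite subr_gt0.
have c0 := normr_ge0 c; have := ler_norm c => cc.
have B0 : 0 < 2 * (`|c| + 1 + D) by lra.
pose h := D / (2 * (`|c| + 1 + D)).
have h0 : 0 < h by rewrite divr_gt0.
have hB : h * (2 * (`|c| + 1 + D)) = D by rewrite /h divfK // gt_eqF.
have h1 : h < 1 by rewrite ltr_pdivrMr //; lra.
have /H : 0 < h < 1 by rewrite h0.
have : c * h <= `|c| * h by rewrite ler_wpM2r // ltW.
move: hB; rewrite /D; nra.
Qed.

Lemma le_of_le_add_geometric a b c r : 0 <= r < 1 ->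
  (forall n, a <= b + c * r ^+ n) -> a <= b.
Proof.
case/andP=> r0 r1 H.
have cv : (fun n => b + c * r ^+ n) @ \oo --> b + c * 0.
  by apply: cvgD; [exact: cvg_cst|apply: cvgMr; apply: cvg_expr; rewrite ger0_norm].
rewrite -[b]addr0 -[X in b + X](mulr0 c) -(cvg_lim _ cv) //.
apply: limr_ge; [exact: (cvgP _ cv)|near=> n; exact: H].
Unshelve. all: by end_near. Qed.

Lemma bernoulli_ineq (h : R) n : 0 <= h <= 1 -> 1 - n%:R * h <= (1 - h) ^+ n.
Proof.
case/andP=> h0 h1; elim: n => [|n IH]; first by rewrite mul0r subr0.
rewrite exprSr -natr1.
have : (1 - n%:R * h) * (1 - h) <= (1 - h) ^+ n * (1 - h).
  by rewrite ler_wpM2r // subr_ge0.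
have : 0 <= n%:R * (h * h) by rewrite !mulr_ge0.
lra.
Qed.

End Limits.

(** * The race of independent exponential clocks *)

Section ExponentialRace.
Context {d : measure_display} {T : measurableType d} {R : realType}.
Context (P : probability T R) (K : finType) (E : {set K}).
Context (W : set T) (rho : K -> T -> R) (p : R).
Hypotheses (mW : measurable W) (mrho : forall k, k \in E -> measurable_fun setT (rho k)).

Let tail (x : K -> R) : set T := W `&` [set w | forall k, k \in E -> x k < rho k w].

Hypothesis P_tail : forall x : K -> R, (forall k, 0 <= x k) ->
  P (tail x) = (p * \prod_(k in E) expR (- x k))%:E.

Let m_tail x : measurable (tail x).
Proof.
apply: measurableI => //; apply: measurable_forall => k kE.
exact/measurable_gt/mrho.
Qed.

Context (e : K) (x : K -> R).
Hypotheses (eE : e \in E) (x_ge0 : forall k, 0 <= x k).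

Let race : set T := W `&` [set w | 0 < rho e w /\
  forall k, k \in E -> k != e -> x k < rho k w - rho e w].

Let m_race : measurable race.
Proof.
apply: measurableI => //.
rewrite [X in measurable X](_ : _ = [set w | 0 < rho e w] `&`
    [set w | forall k, (k \in E) && (k != e) -> x k < rho k w - rho e w]).
  apply: measurableI; first exact/measurable_gt/mrho.
  apply: measurable_forall => k /andP[kE _]; apply: measurable_gt.
  by apply: measurable_funB; apply: mrho.
apply/seteqP; split => w /= [H1 H2]; split => // k; first by case/andP; apply: H2.
by move=> kE ke; apply: H2; rewrite kE.
Qed.

Let q : R := p * \prod_(k in E | k != e) expR (- x k).

Let p_ge0 : 0 <= p.
Proof.
have := P_tail (fun=> lexx 0); rewrite big1 ?mulr1; last first.
  by move=> k _; rewrite oppr0 exp.expR0.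
by move=> H; rewrite -lee_fin -H.
Qed.

Let q_ge0 : 0 <= q.
Proof. by rewrite mulr_ge0 //; apply: prodr_ge0 => k _; apply: expR_ge0. Qed.

Section Discretization.
Context (r : R) (r01 : 0 < r < 1).

Let h := - ln r.

Let h_gt0 : 0 < h.
Proof. by rewrite oppr_gt0 ln_lt0. Qed.

Let expRNh n : expR (- (n%:R * h)) = r ^+ n.
Proof. by case/andP: r01 => r0 _; rewrite mulrN opprK expRM_natl lnK. Qed.

Let grid (i j : nat) : set T :=
  tail (fun k => if k == e then i%:R * h else x k + j%:R * h).

Let P_grid i j : P (grid i j) = (q * r ^+ (i + #|E|.-1 * j))%:E.
Proof.
rewrite P_tail; last first.
  by move=> k; case: ifP => _; rewrite ?addr_ge0 // mulr_ge0 // ltW.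
congr EFin; rewrite (bigD1 e) //= eqxx expRNh /q -mulrA; congr (_ * _).
rewrite exprD mulrCA; congr (_ * _).
have -> : r ^+ (#|E|.-1 * j) = \prod_(k in E | k != e) r ^+ j.
  rewrite prodr_const -exprM mulnC; congr (_ ^+ (_ * _)).
  rewrite (cardsD1 e) eE /=; apply: eq_card => k.
  by rewrite !inE unfold_in /= andbC.
rewrite -big_split /=; apply: eq_bigr => k /andP[_ /negbTE ->].
by rewrite opprD exp.expRD expRNh.
Qed.

(** The ring of [e] falls in the interval from [i * h] to [(i + 1) * h], and every other clock
    exceeds [x k + j * h]. Cells with [j = i + 1] are disjoint and lie inside the race; cells with
    [j = i], [i < M], cover the race up to the event that [e] rings after [M * h]. Only joint tails
    enter, so no density is integrated. *)
Let cell (i j : nat) : set T := grid i j `\` grid i.+1 j.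

Let m_cell i j : measurable (cell i j).
Proof. by apply: measurableD; apply: m_tail. Qed.

Let P_cell i j : P (cell i j) = (q * r ^+ (i + #|E|.-1 * j) * (1 - r))%:E.
Proof.
have gridI : grid i j `&` grid i.+1 j = grid i.+1 j.
  rewrite setIC; apply/setIidl => w [Ww H]; split=> // k kE.
  have := H k kE; case: ifP => // _; apply: le_lt_trans.
  by rewrite ler_wpM2r ?ler_nat // ltW.
transitivity (P (grid i j) - P (grid i.+1 j))%E; last first.
  by rewrite !P_grid -EFinB addSn exprS; congr EFin; ring.
rewrite -[X in _ = (_ - P X)%E]gridI; apply: measureD; try exact: m_tail.
by rewrite (le_lt_trans (probability_le1 _ _)) ?ltry //; apply: m_tail.
Qed.

Let g : R := \sum_(l < #|E|) r ^+ l.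

Let D_gt0 : (0 < #|E|)%N. Proof. by apply/card_gt0P; exists e. Qed.

(** A geometric sum of ratio [r ^+ #|E|], combined with [1 - r ^+ #|E| = (1 - r) * g]. As [r] tends
    to 1, [g] tends to [#|E|]: this is the origin of the uniform choice of the edge. *)
Let cell_sum (c : R) (M : nat) :
  (\sum_(i < M) c * r ^+ (i + #|E|.-1 * i) * (1 - r)) * g =
  c * (1 - r ^+ (#|E| * M)).
Proof.
have rg : (1 - r) * g = 1 - r ^+ #|E|.
  rewrite /g; elim: #|E| => [|n IH]; first by rewrite big_ord0 mulr0 subrr.
  by rewrite big_ord_recr /= mulrDr IH exprSr; ring.
elim: M => [|M IH]; first by rewrite big_ord0 mul0r muln0 subrr mulr0.
rewrite big_ord_recr /= mulrDl IH -mulrA rg -mulSn prednK // mulnS exprD.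
ring.
Qed.

Let g_ge0 : 0 <= g.
Proof. by case/andP: r01 => r0 _; apply: sumr_ge0 => l _; rewrite exprn_ge0 // ltW. Qed.

Lemma race_upper M : fine (P race) * (\sum_(l < #|E|) r ^+ l)
  <= q * (1 - r ^+ (#|E| * M)) + p * r ^+ M * (\sum_(l < #|E|) r ^+ l).
Proof.
rewrite -/g.
pose F i := if i == M then tail (fun k => if k == e then M%:R * h else 0) else cell i i.
have mF k : measurable (F k) by rewrite /F; case: ifP => _ //; apply: m_tail.
have := @content_subadditive _ _ _ P race F M.+1 (fun k _ => mF k) m_race.
have cover : race `<=` \big[setU/set0]_(k < M.+1) F k.
  move=> w [Ww [e0 H]]; rewrite -bigcup_mkord.
  have rk k : k \in E -> k != e -> rho e w < rho k w.
    by move=> kE ke; have := H k kE ke; have := x_ge0 k; lra.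
  have [Me|eM] := ltP (M%:R * h) (rho e w).
    exists M => //=; rewrite /F eqxx; split=> // k kE.
    case: eqP => [->//|/eqP ke]; exact: lt_trans (rk k kE ke).
  have : exists i, (i < M)%N && ((i%:R * h < rho e w) && (rho e w <= i.+1%:R * h)).
    elim: M eM {F mF} => [|M IH] eM; first by move: eM; rewrite mul0r leNgt e0.
    have [Me|Me] := ltP (M%:R * h) (rho e w); first by exists M; rewrite ltnSn Me eM.
    have [i /andP[iM Hi]] := IH Me; exists i.
    by rewrite Hi andbT ltnS ltnW.
  move=> [i /andP[iM /andP[ie ei]]]; exists i; first by rewrite /= ltnS ltnW.
  rewrite /F ltn_eqF //; split.
    split=> // k kE; case: eqP => [->//|/eqP ke].
    by have := H k kE ke; lra.
  by move=> [_ /(_ e eE)]; rewrite eqxx ltNge ei.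
move=> /(_ cover); rewrite big_ord_recr /= {2}/F eqxx P_tail; last first.
  by move=> k; case: ifP => // _; rewrite mulr_ge0 // ltW.
rewrite (eq_bigr (fun i : 'I_M => (q * r ^+ (i + #|E|.-1 * i) * (1 - r))%:E)).
  have -> : \prod_(k in E) expR (- (if k == e then M%:R * h else 0)) = r ^+ M.
    rewrite (bigD1 e) //= eqxx expRNh big1 ?mulr1 // => k /andP[_ /negbTE ->].
    by rewrite oppr0 exp.expR0.
  rewrite sumEFin -EFinD.
  move=> H; rewrite -cell_sum -mulrDl ler_wpM2r //.
  by rewrite -lee_fin fineK // fin_num_measure.
by move=> i _; rewrite /F ltn_eqF ?ltn_ord.
Qed.

Lemma race_lower M :
  q * r ^+ #|E|.-1 * (1 - r ^+ (#|E| * M))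
    <= fine (P race) * (\sum_(l < #|E|) r ^+ l).
Proof.
rewrite -/g.
pose F i := cell i i.+1.
have mF k : measurable (F k) by apply: m_cell.
have tF : trivIset setT F.
  apply/trivIsetP => i j _ _; wlog ij : i j / (i < j)%N.
    move=> H; have [ij ?|ji ?|->] := ltngtP i j; last by [].
      by apply: H => //; rewrite ltn_eqF.
    by rewrite setIC; apply: H => //; rewrite ltn_eqF.
  move=> _; apply/seteqP; split=> // w [[[Ww H1] H2] [[_ H3] _]]; apply: H2.
  split=> // k kE; have := H1 k kE; have := H3 k kE; case: ifP => // _.
  by move=> H _; apply: le_lt_trans H; rewrite ler_wpM2r ?ler_nat // ltW.
have sub : \big[setU/set0]_(k < M) F k `<=` race.
  rewrite -bigcup_mkord => w [i _ [[Ww H1] H2]]; split=> //.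
  have ei : rho e w <= i.+1%:R * h.
    rewrite leNgt; apply/negP => ei; apply: H2; split=> // k kE.
    by have := H1 k kE; case: eqP => [->|].
  split; first by have := H1 e eE; rewrite eqxx; apply: le_lt_trans; rewrite mulr_ge0 // ltW.
  by move=> k kE ke; have := H1 k kE; rewrite (negbTE ke); lra.
have : (P (\big[setU/set0]_(k < M) F k) <= P race)%E.
  by apply: le_measure; rewrite ?inE //; apply: bigsetU_measurable.
rewrite measure_bigsetU //.
rewrite (eq_bigr (fun i : 'I_M =>
    (q * r ^+ #|E|.-1 * r ^+ (i + #|E|.-1 * i) * (1 - r))%:E)); last first.
  move=> i _; transitivity (P (cell i i.+1)) => //.
  by rewrite P_cell mulnS addnCA exprD; congr EFin; ring.
rewrite sumEFin => H; rewrite -cell_sum ler_wpM2r //.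
by rewrite -lee_fin fineK // fin_num_measure.
Qed.

End Discretization.

(* Memorylessness of the minimum: the residual clocks after the first ring are
   again exponential, and independent of which clock rang first. *)
Lemma exponential_race :
  P (W `&` [set w | 0 < rho e w /\
       forall k, k \in E -> k != e -> x k < rho k w - rho e w])
  = (p / #|E|%:R * \prod_(k in E | k != e) expR (- x k))%:E.
Proof.
rewrite -/race mulrAC -/q.
have D0 : 0 < #|E|%:R :> R by rewrite ltr0n; apply/card_gt0P; exists e.
rewrite -[LHS]fineK; last exact: fin_num_measure.
set a := fine _; congr EFin.
have a0 : 0 <= a by apply: fine_ge0.
apply/eqP; rewrite -(inj_eq (mulIf (lt0r_neq0 D0))) divfK ?lt0r_neq0 //.
have hE (h : R) : 0 < h < 1 -> 0 < 1 - h < 1 by case/andP => ? ?; apply/andP; split; lra.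
pose g (h : R) := \sum_(l < #|E|) (1 - h) ^+ l.
have g_le h : 0 < h < 1 -> g h <= #|E|%:R.
  case/andP => h0 h1; have -> : #|E|%:R = \sum_(l < #|E|) (1 : R).
    by rewrite sumr_const card_ord.
  by apply: ler_sum => l _; rewrite exprn_ile1 //; lra.
have g_ge h : 0 < h < 1 -> #|E|%:R - #|E|%:R ^+ 2 * h <= g h.
  case/andP => h0 h1.
  have -> : #|E|%:R - #|E|%:R ^+ 2 * h = \sum_(l < #|E|) (1 - #|E|%:R * h).
    by rewrite sumr_const card_ord -[RHS]mulr_natl; ring.
  apply: ler_sum => l _; apply: le_trans (bernoulli_ineq l _); last by lra.
  by rewrite lerD2l lerN2 ler_wpM2r ?(ltW h0) // ler_nat ltnW.
rewrite eq_le; apply/andP; split.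
  (* Here [h] stands for [1 - r]. At fixed [r] the number of cells goes to infinity, and then [h]
     goes to 0. *)
  apply: (@le_of_le_add_small _ _ _ (a * #|E|%:R ^+ 2)) => h h01.
  suff agq : a * g h <= q.
    by have := ler_wpM2l a0 (g_ge h h01); move: agq; lra.
  have [h0 h1] := andP (hE h h01).
  apply: (@le_of_le_add_geometric _ _ _ (p * g h) (1 - h)).
    by rewrite h1 (ltW h0).
  move=> n; apply: le_trans (race_upper (hE h h01) n) _.
  rewrite -/(g h) [p * g h * _]mulrAC lerD2r -[leRHS]mulr1 ler_wpM2l // lerBlDr lerDl.
  exact/exprn_ge0/ltW.
apply: (@le_of_le_add_small _ _ _ (q * #|E|.-1%:R)) => h h01.
have [h0 h1] := andP (hE h h01).
have qag : q * (1 - h) ^+ #|E|.-1 <= a * g h.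
  apply: (@le_of_le_add_geometric _ _ _ (q * (1 - h) ^+ #|E|.-1) ((1 - h) ^+ #|E|)).
    rewrite exprn_ge0 ?(ltW h0) //= exprn_ilt1 ?(ltW h0) //.
    by rewrite -lt0n; apply/card_gt0P; exists e.
  by move=> n; have := race_lower (hE h h01) n; rewrite -/(g h) -/a exprM; lra.
have := ler_wpM2l a0 (g_le h h01).
have : q * (1 - #|E|.-1%:R * h) <= q * (1 - h) ^+ #|E|.-1.
  by rewrite ler_wpM2l // bernoulli_ineq //; lra.
lra.
Qed.

End ExponentialRace.

(** * Joint law of the opinions, the ring order and the residual clocks *)

Section RingWords.
Context {d : measure_display} {T : measurableType d} {R : realType}.
Context {P : probability T R} {V : finType} (E : {set {set V}}).
Context (f0 : V -> {RV P >-> R}) (X : {set V} -> nat -> {RV P >-> R}).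
Implicit Types (e k : {set V}) (s : seq {set V}).

Definition ring_time w k m : R := \sum_(i < m.+1) X k i w.

Definition last_ring s w : R :=
  if s is e :: s' then ring_time w e (count_mem e s') else 0.

(** The residual waiting time of [k] after the history [s]. Rings are numbered from 0, so
    [count_mem k s] is the number of the next ring. *)
Definition resid s k w : R := ring_time w k (count_mem k s) - last_ring s w.

(* The rings occur in the order prescribed by [s], whose head is the most
   recent one, with no simultaneous rings. *)
Fixpoint ring_order s : set T :=
  if s is e :: s' then
    ring_order s' `&` [set w | 0 < resid s' e w /\
      forall k, k \in E -> k != e -> resid s' e w < resid s' k w]
  else setT.

Definition resid_gt s (x : {set V} -> R) : set T :=
  [set w | forall k, k \in E -> x k < resid s k w].

Definition init_in (B : V -> set R) : set T := [set w | forall v, B v (f0 v w)].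

Definition fresh_in (l : seq ({set V} * nat)) (A : {set V} * nat -> set R) : set T :=
  [set w | forall km, km \in l -> A km (X km.1 km.2 w)].

Lemma last_ring_cons s e w :
  last_ring (e :: s) w = last_ring s w + resid s e w.
Proof. by rewrite /resid /= addrC subrK. Qed.

Lemma resid_cons_neq s e k w : k != e ->
  resid (e :: s) k w = resid s k w - resid s e w.
Proof.
move=> ke; rewrite /resid /= eq_sym (negbTE ke) add0n.
by rewrite opprB addrA subrK.
Qed.

Lemma resid_cons_eq s e w : resid (e :: s) e w = X e (count_mem e s).+1 w.
Proof.
by rewrite /resid /= eqxx add1n /ring_time big_ord_recr /= addrAC subrr add0r.
Qed.

Lemma measurable_resid s k : measurable_fun setT (resid s k).
Proof.
apply: measurable_funB; first by apply: measurable_sum => i; exact: measurable_funPT.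
case: s => [|e s] /=; first exact: measurable_cst.
by apply: measurable_sum => i; exact: measurable_funPT.
Qed.

Lemma measurable_ring_order s : measurable (ring_order s).
Proof.
elim: s => [|e s IH] /=; first exact: measurableT.
apply: measurableI => //.
rewrite [X in measurable X](_ : _ = [set w | 0 < resid s e w] `&`
    [set w | forall k, (k \in E) && (k != e) -> 0 < resid s k w - resid s e w]).
  apply: measurableI; first exact/measurable_gt/measurable_resid.
  apply: measurable_forall => k _; apply: measurable_gt.
  by apply: measurable_funB; apply: measurable_resid.
apply/seteqP; split => w /= [H1 H2]; split => // k.
  by case/andP => kE ke; rewrite subr_gt0 H2.
by move=> kE ke; rewrite -subr_gt0 H2 // kE.
Qed.

Lemma measurable_resid_gt s x : measurable (resid_gt s x).
Proof. by apply: measurable_forall => k _; apply/measurable_gt/measurable_resid. Qed.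

Lemma measurable_init_in B : (forall v, measurable (B v)) -> measurable (init_in B).
Proof.
move=> mB; rewrite /init_in [X in measurable X](_ : _ =
    [set w | forall v, True -> B v (f0 v w)]); last first.
  by apply/seteqP; split => w /= H v; [move=> _|]; apply: H.
apply: measurable_forall => v _; rewrite -[X in measurable X]setTI.
exact: measurable_funPT.
Qed.

Lemma measurable_fresh_in l A : (forall km, measurable (A km)) ->
  measurable (fresh_in l A).
Proof.
move=> mA; apply: (@measurable_forall _ _ _ (fun km => km \in l)) => km _.
rewrite -[X in measurable X]setTI; exact: measurable_funPT.
Qed.

Hypothesis expX : forall k m (A : set R), k \in E -> measurable A ->
  distribution P (X k m) A = exponential_prob 1 A.

Lemma exponential_tail k m (x : R) : k \in E -> 0 <= x ->
  P (X k m @^-1` `]x, +oo[) = (expR (- x))%:E.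
Proof.
move=> kE x0.
have mX A : measurable A -> measurable (X k m @^-1` A).
  by move=> mA; rewrite -[X in measurable X]setTI; exact: measurable_funPT.
have neg : P (X k m @^-1` `]-oo, 0[) = 0%E.
  rewrite -[LHS]/(distribution P (X k m) `]-oo, 0[%classic) expX //.
  apply: integral0_eq => y /=; rewrite in_itv /= => y0.
  by rewrite lt0_exponential_pdf.
have pos : P (X k m @^-1` `[0, x]) = (1 - expR (- x))%:E.
  rewrite -[LHS]/(distribution P (X k m) `[0, x]%classic) expX //.
  move: x0; rewrite le_eqVlt => /orP[/eqP <-|x0].
    by rewrite oppr0 exp.expR0 subrr set_itv1 /exponential_prob integral_set1.
  by rewrite exponential_prob_itv0c // mulN1r.
have -> : X k m @^-1` `]x, +oo[ =
    ~` (X k m @^-1` `]-oo, 0[ `|` X k m @^-1` `[0, x]).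
  apply/seteqP; split => w /=; rewrite !in_itv /= andbT.
    by move=> xX [|/andP[]]; lra.
  move=> H; rewrite ltNge; apply/negP => Xx; apply: H.
  by have [?|?] := ltP (X k m w) 0; [left|right].
rewrite probability_setC; last by apply: measurableU; apply: mX.
rewrite measureU; [|exact: mX|exact: mX|].
  by rewrite [X in (_ - (X + _))%E]neg add0e [X in (_ - X)%E]pos -EFinB; congr EFin; ring.
apply/seteqP; split=> // w [] /=; rewrite !in_itv /= => X0 /andP[]; lra.
Qed.

Hypothesis indep : mutually_independent P (ea_index E)
  (fun i => match i with
            | inl v => (f0 v : T -> R)
            | inr km => (X km.1 km.2 : T -> R)
            end).

Let pr (A : set T) : R := fine (P A).

Let word_law_nil B l A x :
  (forall v, measurable (B v)) -> (forall km, measurable (A km)) ->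
  uniq l -> all (fun km => (km.1 \in E) && (0 < km.2)%N) l ->
  (forall k, 0 <= x k) ->
  P ((init_in B `&` fresh_in l A) `&` resid_gt [::] x)
  = ((\prod_v pr (f0 v @^-1` B v)) * (\prod_(km <- l) pr (X km.1 km.2 @^-1` A km))
     * \prod_(k in E) expR (- x k))%:E.
Proof.
move=> mB mA ul al x0.
pose C i : set R := match i with
  | inl v => B v
  | inr km => if km.2 == 0%N then `]x km.1, +oo[%classic else A km
  end.
pose firsts := [seq (k, 0%N) | k <- enum E].
pose s : seq (V + {set V} * nat) :=
  [seq inl v | v <- index_enum V] ++ [seq inr km | km <- l ++ firsts].
have us : uniq s.
  have u1 : uniq ([seq inl v | v <- index_enum V] : seq (V + {set V} * nat)).
    by rewrite map_inj_uniq ?index_enum_uniq // => ? ? [].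
  have u2 : uniq firsts by rewrite map_inj_uniq ?enum_uniq // => ? ? [].
  have u3 : uniq (l ++ firsts).
    rewrite cat_uniq ul u2 andbT; apply/hasPn => km /mapP[k _ ->].
    by apply/negP => kl; have := allP al _ kl; rewrite andbF.
  have u4 : uniq ([seq inr km | km <- l ++ firsts] : seq (V + {set V} * nat)).
    by rewrite map_inj_uniq // => ? ? [].
  rewrite /s cat_uniq u1 u4 andbT; apply/hasPn => i /mapP[km _ ->].
  by apply/negP => /mapP[].
have sE i : i \in s -> ea_index E i.
  rewrite mem_cat => /orP[/mapP[v _ ->]//|/mapP[km + ->]].
  rewrite mem_cat => /orP[/(allP al)/andP[]//|/mapP[k + ->]].
  by rewrite mem_enum.
have mC i : measurable (C i).
  by case: i => [v|km] /=; [|case: ifP].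
have := indep us sE mC.
have -> : \bigcap_(i in [set` s]) ((match i with
            | inl v => (f0 v : T -> R)
            | inr km => (X km.1 km.2 : T -> R)
            end) @^-1` C i) = (init_in B `&` fresh_in l A) `&` resid_gt [::] x.
  have r0 k w : resid [::] k w = X k 0%N w.
    by rewrite /resid /= subr0 /ring_time big_ord_recl big_ord0 addr0.
  apply/seteqP; split => w.
    move=> H; split; first split.
    - move=> v; apply: (H (inl v)) => /=.
      by rewrite mem_cat map_f ?mem_index_enum.
    - move=> km kml; have := H (inr km); rewrite /= ifF; last first.
        by have /andP[_] := allP al _ kml; case: (km.2).
      by apply; rewrite mem_cat (map_f inr) ?orbT // mem_cat kml.
    - move=> k kE; have := H (inr (k, 0%N)); rewrite /= in_itv /= andbT r0.
      by apply; rewrite mem_cat (map_f inr) ?orbT // mem_cat map_f ?orbT // mem_enum.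
  case=> [[Hv Hl] Hk] i /=; rewrite mem_cat => /orP[/mapP[v _ ->]|/mapP[km + ->]].
    exact: Hv.
  rewrite mem_cat => /orP[kml|/mapP[k + ->]] /=.
    rewrite ifF; first exact: Hl.
    by have /andP[_] := allP al _ kml; case: (km.2).
  by rewrite mem_enum => kE; rewrite in_itv /= andbT -r0; apply: Hk.
move=> ->.
have mpre (f : {RV P >-> R}) (D : set R) : measurable D ->
    P (f @^-1` D) = (pr (f @^-1` D))%:E.
  move=> mD; rewrite /pr fineK // fin_num_measure //.
  by rewrite -[X in measurable X]setTI; exact: measurable_funPT.
have EFin_prod (I : eqType) (r : seq I) (Q : pred I) (F : I -> R) :
    (\prod_(i <- r | Q i) (F i)%:E)%E = (\prod_(i <- r | Q i) F i)%:E.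
  by rewrite (big_morph EFin (id1 := 1%E) (op1 := *%E)).
rewrite big_cat !big_map big_cat big_map big_enum.
rewrite (eq_bigr (fun v => (pr (f0 v @^-1` B v))%:E)); last by move=> v _; apply: mpre.
rewrite EFin_prod.
rewrite (eq_big_seq (fun km => (pr (X km.1 km.2 @^-1` A km))%:E)); last first.
  move=> km kml; rewrite /= ifF; first exact: mpre.
  by have /andP[_] := allP al _ kml; case: (km.2).
rewrite EFin_prod (eq_bigr (fun k => (expR (- x k))%:E)); last first.
  by move=> k kE; apply: exponential_tail.
by rewrite !EFin_prod /= -!EFinM mulrA.
Qed.

(** Induction on the history, one race per letter. The list [l] holds interarrival times that have
    not yet started after [s]; without it the induction would not close, since the clock that rings
    restarts with such a variable. *)
Lemma word_law s B l A x : all (mem E) s ->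
  (forall v, measurable (B v)) -> (forall km, measurable (A km)) ->
  uniq l -> all (fun km => (km.1 \in E) && (count_mem km.1 s < km.2)%N) l ->
  (forall k, 0 <= x k) ->
  P ((init_in B `&` fresh_in l A `&` ring_order s) `&` resid_gt s x)
  = ((\prod_v fine (P (f0 v @^-1` B v)))
     * (\prod_(km <- l) fine (P (X km.1 km.2 @^-1` A km)))
     * #|E|%:R^-1 ^+ size s * \prod_(k in E) expR (- x k))%:E.
Proof.
elim: s B l A x => [|e s IH] B l A x /=.
  by move=> _ mB mA ul al x0; rewrite setIT expr0 mulr1 word_law_nil.
move=> /andP[eE sE] mB mA ul al x0.
(* After the ring of [e] its residual is the next interarrival time, still unstarted after [s]: its
   threshold moves into the list, and the thresholds of the other clocks go into the race. *)
pose l' := (e, (count_mem e s).+1) :: l.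
pose A' km := if km == (e, (count_mem e s).+1) then `]x e, +oo[%classic else A km.
have notin : (e, (count_mem e s).+1) \notin l.
  apply/negP => el; have := allP al _ el; rewrite /= eqxx add1n ltnn.
  by rewrite andbF.
have mA' km : measurable (A' km) by rewrite /A'; case: ifP.
have ul' : uniq l' by rewrite /= notin.
have al' : all (fun km => (km.1 \in E) && (count_mem km.1 s < km.2)%N) l'.
  rewrite /= eE ltnSn /=; apply/allP => km kml.
  have /andP[-> H] := allP al _ kml; apply: leq_ltn_trans H.
  exact: leq_addl.
have race := exponential_race (P := P) (E := E) (rho := resid s)
  (W := init_in B `&` fresh_in l' A' `&` ring_order s) _ _
  (fun y y0 => IH B l' A' y sE mB mA' ul' al' y0) eE x0.
transitivity (P ((init_in B `&` fresh_in l' A' `&` ring_order s) `&`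
   [set w | 0 < resid s e w /\
       forall k, k \in E -> k != e -> x k < resid s k w - resid s e w])).
  congr (P _); apply/seteqP; split => w.
    move=> [[[Hi Hf] [Ho [e0 He]]] Hx]; split; first split => //; first split => //.
      move=> km; rewrite inE /A' => /orP[/eqP ->|kml]; rewrite ?eqxx.
        by have := Hx e eE; rewrite resid_cons_eq /= in_itv /= andbT.
      by case: eqP => [km_e|_]; [rewrite -km_e kml in notin|apply: Hf].
    split=> // k kE ke; have := Hx k kE; rewrite resid_cons_neq //.
  move=> [[[Hi Hf] Ho] [e0 He]]; split; first split; first split => //.
  - move=> km kml; have := Hf km; rewrite inE kml orbT /A' => /(_ isT).
    by case: eqP => // km_e; rewrite -km_e kml in notin.
  - split=> //; split=> // k kE ke; have := He k kE ke; have := x0 k; lra.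
  - move=> k kE; have [->|ke] := eqVneq k e.
      have := Hf (e, (count_mem e s).+1); rewrite inE eqxx /A' eqxx => /(_ isT).
      by rewrite resid_cons_eq /= in_itv /= andbT.
    by rewrite resid_cons_neq //; apply: He.
rewrite race.
- congr EFin; rewrite big_cons {1}/A' eqxx exponential_tail //.
  rewrite (eq_big_seq (fun km => fine (P (X km.1 km.2 @^-1` A km)))); last first.
    move=> km kml; rewrite /A'; case: eqP => // km_e.
    by rewrite -km_e kml in notin.
  by rewrite exprS [in RHS](bigD1 e) //=; ring.
- by apply: measurableI; [apply: measurableI|apply: measurable_ring_order];
    [apply: measurable_init_in|apply: measurable_fresh_in].
- by move=> k _; apply: measurable_resid.
Qed.

End RingWords.

(** * The process along a path without simultaneous rings *)

Section Pathwise.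
Context {d : measure_display} {T : measurableType d} {R : realType}.
Context {P : probability T R} {V : finType} (E : {set {set V}}).
Context (X : {set V} -> nat -> {RV P >-> R}).
Implicit Types (e k : {set V}) (s : seq {set V}) (w : T).

Lemma ring_order_inj s s' w : size s = size s' ->
  all (mem E) s -> all (mem E) s' ->
  ring_order E X s w -> ring_order E X s' w -> s = s'.
Proof.
elim: s s' => [|e s IH] [|e' s'] //= [ss'] /andP[eE sE] /andP[e'E s'E].
move=> [Hs [_ He]] [Hs' [_ He']]; have ? := IH _ ss' sE s'E Hs Hs'; subst s'.
congr cons; apply/eqP; apply/negPn/negP => ee'.
have := He e' e'E; rewrite eq_sym => /(_ ee').
by have := He' e eE ee'; lra.
Qed.

Context (w : T) (word : nat -> seq {set V}).
Hypothesis wordE : forall j, all (mem E) (word j).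
Hypothesis size_word : forall j, size (word j) = j.
Hypothesis word_order : forall j, ring_order E X (word j) w.
Hypothesis word_resid : forall j, resid_gt E X (word j) (fun=> 0) w.

Let rt k m : R := \sum_(i < m.+1) X k i w.

(** The words are given separately for each length; since a strict minimizer is unique, so is the
    ring order, and the words are nested in one infinite history. *)
Lemma wordS j : exists e, [/\ word j.+1 = e :: word j, e \in E
  & last_ring X (word j.+1) w = last_ring X (word j) w + resid X (word j) e w].
Proof.
have := size_word j.+1; have := wordE j.+1; have := word_order j.+1.
case: (word j.+1) => [//|e s] /= [Hs _] /andP[eE sE] [sj].
exists e; have -> : s = word j.
  by apply: (ring_order_inj _ sE (wordE j) Hs (word_order j)); rewrite size_word.
by split => //; rewrite -last_ring_cons.
Qed.

Lemma word_head_min j e : word j.+1 = e :: word j ->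
  forall k, k \in E -> resid X (word j) e w <= resid X (word j) k w.
Proof.
move=> We k kE; have [->//|ke] := eqVneq k e.
by have := word_order j.+1; rewrite We => -[_ [_ H]]; apply/ltW/H.
Qed.

Lemma last_word_lt j : last_ring X (word j) w < last_ring X (word j.+1) w.
Proof.
by have [e [_ eE ->]] := wordS j; rewrite ltrDl word_resid.
Qed.

(** Strict minimality of the residual leaves a single candidate to [pick]. *)
Lemma next_edge_word j e : word j.+1 = e :: word j ->
  next_edge E rt (fun k => count_mem k (word j)) = Some e.
Proof.
move=> We; have eE : e \in E by have := wordE j.+1; rewrite We => /andP[].
have := word_order j.+1; rewrite We => -[_ [_ He]].
have lt k : k \in E -> k != e ->
    rt e (count_mem e (word j)) < rt k (count_mem k (word j)).
  by move=> kE ke; have := He k kE ke; rewrite /resid /ring_time ltrD2r.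
rewrite /next_edge; case: pickP => [k /andP[kE /forallP/(_ e)]|/(_ e)].
  rewrite eE /= => ke; congr Some; apply/eqP/negPn/negP => nke.
  by have := lt k kE nke; rewrite ltNge ke.
rewrite eE /= => /negP; case; apply/forallP => k; apply/implyP => kE.
by have [->//|ke] := eqVneq k e; apply/ltW/lt.
Qed.

Lemma ev_word (f : V -> R) j :
  ev E rt f j = (act (word j) f, fun k => count_mem k (word j)).
Proof.
elim: j => [|j IH]; first by rewrite (size0nil (size_word 0%N)).
have [e [We eE _]] := wordS j.
rewrite /= IH (next_edge_word We) We; congr pair.
by apply/funext => k /=; have [->|] := eqVneq k e.
Qed.

Lemma ev_time_word (f : V -> R) j :
  ev_time E rt f j = Some (last_ring X (word j.+1) w).
Proof.
have [e [We _ _]] := wordS j.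
by rewrite /ev_time ev_word /= (next_edge_word We) We.
Qed.

Lemma last_word_homo i j : (i <= j)%N ->
  last_ring X (word i) w <= last_ring X (word j) w.
Proof.
move=> ij; rewrite -(subnK ij); elim: (j - i)%N => [//|n IH].
by rewrite addSn; apply: le_trans IH _; apply/ltW/last_word_lt.
Qed.

Lemma consensus_time_le (f : V -> R) eps j : osc (act (word j) f) <= eps ->
  (consensus_time E rt f eps <= (last_ring X (word j) w)%:E)%E.
Proof.
move=> oe; apply: ereal_inf_lbound => /=; exists (last_ring X (word j) w) => //.
split.
  have := last_word_homo (leq0n j).
  by rewrite {1}(size0nil (size_word 0%N)).
exists (act (word j) f); split=> //; exists j; split; first by rewrite ev_word.
split=> [i ij|s]; rewrite ev_time_word.
  by exists (last_ring X (word i.+1) w) => //; apply: last_word_homo.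
by case=> <-; apply: last_word_lt.
Qed.

End Pathwise.

(** * Almost surely the rings are strictly ordered *)

Section AlmostSureOrder.
Context {d : measure_display} {T : measurableType d} {R : realType}.
Context {P : probability T R} {V : finType} (E : {set {set V}}).
Context (f0 : V -> {RV P >-> R}) (X : {set V} -> nat -> {RV P >-> R}).
Hypothesis E_gt0 : (0 < #|E|)%N.
Hypothesis expX : forall k m (A : set R), k \in E -> measurable A ->
  distribution P (X k m) A = exponential_prob 1 A.
Hypothesis indep : mutually_independent P (ea_index E)
  (fun i => match i with
            | inl v => (f0 v : T -> R)
            | inr km => (X km.1 km.2 : T -> R)
            end).

Definition word_event (B : V -> set R) (s : seq {set V}) (y : R) : set T :=
  init_in f0 B `&` ring_order E X s `&` resid_gt E X s (fun=> y).

Lemma measurable_word_event B s y : (forall v, measurable (B v)) ->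
  measurable (word_event B s y).
Proof.
move=> mB; apply: measurableI; last exact: measurable_resid_gt.
by apply: measurableI; [apply: measurable_init_in|apply: measurable_ring_order].
Qed.

Lemma word_event_prob B s y : all (mem E) s ->
  (forall v, measurable (B v)) -> 0 <= y ->
  P (word_event B s y) = ((\prod_v fine (P (f0 v @^-1` B v)))
    * #|E|%:R^-1 ^+ size s * expR (- (#|E|%:R * y)))%:E.
Proof.
move=> sE mB y0.
have := word_law expX indep (l := [::]) (A := fun=> setT) (x := fun=> y) sE mB
  (fun=> measurableT) isT isT (fun=> y0).
rewrite big_nil mulr1 prodr_const -expRM_natl mulrN => <-.
congr (P (_ `&` _ `&` _)); apply/seteqP; split=> w /=; last by case.
by move=> H; split.
Qed.

(** The events attached to the [#|E| ^ j] words are disjoint and have probability [#|E| ^ (-j)]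
    each, so they exhaust the mass; the absence of ties comes with the count. *)
Lemma ae_ring_order : {ae P, forall w, forall j, exists s,
  [/\ s \in words E j, ring_order E X s w & resid_gt E X s (fun=> 0) w]}.
Proof.
apply: ae_foralln => j.
pose F s := word_event (fun=> setT) s 0.
pose G := \bigcup_(s in [set` words E j]) F s.
have mF s : measurable (F s) by apply: measurable_word_event.
have mG : measurable G by apply: fin_bigcup_measurable => //; exact: finite_seq.
have PG : P G = 1%E.
  rewrite measure_fin_bigcup //; last 2 first.
  - exact: finite_seq.
  - move=> s s' /=; rewrite !mem_words => /andP[/eqP sj sE] /andP[/eqP s'j s'E].
    move=> [w [[[_ H] _] [[_ H'] _]]].
    by apply: ring_order_inj H H' => //; rewrite sj.
  rewrite -fsbig_seq ?words_uniq //.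
  rewrite (eq_big_seq (fun=> (#|E|%:R^-1 ^+ j)%:E)); last first.
    move=> s; rewrite mem_words => /andP[/eqP sj sE].
    transitivity (P (word_event (fun=> setT) s 0)) => //.
    rewrite word_event_prob // mulr0 oppr0 exp.expR0 mulr1 sj big1 ?mul1r //.
    by move=> v _; rewrite preimage_setT probability_setT.
  rewrite sumEFin (_ : \sum_(s <- words E j) _ = 1) //.
  rewrite -[RHS](@wavg1 R V E j E_gt0) /wavg mulr_sumr.
  by apply: eq_bigr => s _; rewrite mulr1.
exists (~` G); split.
- exact: measurableC.
- by rewrite [LHS](_ : _ = P (~` G)) // probability_setC // [P G]PG subee.
- move=> w /= nH Gw; apply: nH; case: Gw => s sj [[_ H1] H2].
  by exists s.
Qed.

End AlmostSureOrder.

(** * Comparison of integrals with a measurable majorant *)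

Section UpperIntegral.
Import HBNNSimple.
Context {d : measure_display} {T : measurableType d} {R : realType}.
Context (mu : {measure set T -> \bar R}).
Local Open Scope ereal_scope.

(* [f] need not be measurable, the integral being a supremum over simple
   functions below [f]. *)
Lemma integral_le_ae (f g : T -> \bar R) : (forall w, 0 <= f w) ->
  (forall w, 0 <= g w) -> measurable_fun setT g ->
  {ae mu, forall w, f w <= g w} -> \int[mu]_w f w <= \int[mu]_w g w.
Proof.
move=> f_ge0 g_ge0 mg fg; rewrite ge0_integralTE //.
apply: ge_ereal_sup => _ [h hf <-]; rewrite -integralT_nnsfun.
apply: ae_ge0_le_integral => //.
- by move=> w _; rewrite lee_fin; apply: fun_ge0.
- exact/measurable_EFinP/measurable_funPT.
- by apply: filterS fg => w fgw _; apply: le_trans (hf w) fgw.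
Qed.

End UpperIntegral.

(** * Rounding of opinions to a grid *)

Section Grid.
Context {R : realType} (N : nat).
Hypothesis N_gt0 : (0 < N)%N.

(** Half-open cells are disjoint; the last index [N.*2] provides a cell for the opinion 1 itself. *)
Definition grid_point (i : 'I_(N.*2.+1)) : R := i%:R / N%:R - 1.

Definition grid_cell (i : 'I_(N.*2.+1)) : set R :=
  `[grid_point i, grid_point i + N%:R^-1[%classic.

Let n0 : 0 < N%:R :> R. Proof. by rewrite ltr0n. Qed.

Lemma measurable_grid_cell i : measurable (grid_cell i).
Proof. exact: measurable_itv. Qed.

Lemma grid_point_le1 i : `|grid_point i| <= 1.
Proof.
have i0 : 0 <= i%:R / N%:R :> R by rewrite divr_ge0.
have i2 : i%:R / N%:R <= 2 :> R.
  by rewrite ler_pdivrMr // -natrM ler_nat mul2n -ltnS.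
by rewrite /grid_point ler_norml; apply/andP; split; lra.
Qed.

Lemma grid_cell_dist i x : grid_cell i x -> `|x - grid_point i| <= N%:R^-1.
Proof.
rewrite /grid_cell /= in_itv /= => /andP[H1 H2].
by rewrite ler_norml; apply/andP; split; lra.
Qed.

Lemma grid_cell_cover x : `|x| <= 1 -> exists i, grid_cell i x.
Proof.
rewrite ler_norml => /andP[x1 x2].
have y0 : 0 <= (x + 1) * N%:R by rewrite mulr_ge0 //; lra.
have := truncn_itv y0; set t := Num.truncn _ => /andP[t1 t2].
have tN : (t < N.*2.+1)%N.
  rewrite ltnS -(ler_nat R); apply: le_trans t1 _.
  by rewrite -mul2n natrM ler_wpM2r //; lra.
exists (Ordinal tN); rewrite /grid_cell /= in_itv /= /grid_point /=.
have H1 : t%:R / N%:R <= x + 1 by rewrite ler_pdivrMr.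
have H2 : x + 1 < t%:R / N%:R + N%:R^-1.
  have -> : t%:R / N%:R + N%:R^-1 = t.+1%:R / N%:R :> R.
    by rewrite -natr1 mulrDl mul1r.
  by rewrite ltr_pdivlMr.
by apply/andP; split; lra.
Qed.

Lemma grid_cell_inj i j x : grid_cell i x -> grid_cell j x -> i = j.
Proof.
rewrite /grid_cell /= !in_itv /= /grid_point => /andP[i1 i2] /andP[j1 j2].
apply: val_inj; apply/eqP; rewrite eqn_leq.
have le (k l : nat) : k%:R / N%:R - 1 <= x ->
    x < l%:R / N%:R - 1 + N%:R^-1 -> (k <= l)%N.
  move=> H1 H2; rewrite -ltnS -(ltr_nat R).
  have : k%:R / N%:R < (l.+1)%:R / N%:R :> R.
    by rewrite -natr1 mulrDl mul1r; lra.
  by rewrite ltr_pM2r // invr_gt0.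
by rewrite !le.
Qed.

End Grid.

(** Bounds the mean waiting time for a ring, rounded up to a multiple of [1 / #|E|] and measured in
    that unit. *)
Lemma sum_expRN_le2 (R : realType) M : \sum_(i < M) expR (- i%:R) <= 2 :> R.
Proof.
have h : expR (- 1) <= 1 / 2 :> R.
  rewrite expRN mul1r lef_pV2 ?posrE ?expR_gt0 //.
  by have := expR_ge1Dx (1 : R); lra.
suff : \sum_(i < M) expR (- i%:R) <= 2 - 2 * (1 / 2) ^+ M :> R.
  have : 0 <= (1 / 2) ^+ M :> R by rewrite exprn_ge0.
  lra.
elim: M => [|M IH]; first by rewrite big_ord0 expr0; lra.
rewrite big_ord_recr /= exprS.
have : expR (- M%:R) <= (1 / 2) ^+ M :> R.
  rewrite -[M%:R]mulr1 -mulrN expRM_natl lerXn2r ?nnegrE ?expR_ge0 //.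
lra.
Qed.

(** * From the continuous-time process to the jump chain *)

Section ExpectedConsensusTime.
Context {d : measure_display} {T : measurableType d} {R : realType}.
Context {P : probability T R} {V : finType} (E : {set {set V}}).
Context (f0 : V -> {RV P >-> R}) (X : {set V} -> nat -> {RV P >-> R}).
Hypotheses (simpleE : simple_graph E) (connE : connected_graph E).
Hypotheses (E_gt0 : (0 < #|E|)%N) (V_gt1 : (1 < #|V|)%N).
Hypothesis f0_id : forall u v (A : set R), measurable A ->
  distribution P (f0 u) A = distribution P (f0 v) A.
Hypothesis f0_le1 : forall v, {ae P, forall w, `|f0 v w| <= 1}.
Hypothesis expX : forall k m (A : set R), k \in E -> measurable A ->
  distribution P (X k m) A = exponential_prob 1 A.
Hypothesis indep : mutually_independent P (ea_index E)
  (fun i => match i with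
            | inl v => (f0 v : T -> R)
            | inr km => (X km.1 km.2 : T -> R)
            end).
Context (eps : R) (N : nat).
Hypotheses (eps_gt0 : 0 < eps) (N_gt0 : (0 < N)%N) (N_eps : N%:R^-1 <= eps / 4).

Let D : R := #|E|%:R.
Let D_gt0 : 0 < D. Proof. by rewrite ltr0n. Qed.

Let I := 'I_(N.*2.+1).
Let a : I -> R := @grid_point R N.
Let cell : I -> set R := @grid_cell R N.

Let pairs j : seq (seq {set V} * {ffun V -> I}) :=
  [seq (s, g) | s <- words E j, g <- index_enum {ffun V -> I}].

(** Rounding moves each opinion by at most [eps / 4], hence each difference by at most [eps / 2]:
    the level [eps] for true opinions becomes [eps / 2] on the grid. *)
Let chi s (g : {ffun V -> I}) : R := (eps / 2 < osc (act s (a \o g)))%R%:R.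

Let H (sg : seq {set V} * {ffun V -> I}) (i : nat) : set T :=
  word_event E f0 X (fun v => cell (sg.2 v)) sg.1 (i%:R / D).

(* The waiting time for the next ring, at most
   [sum_i 1/D * 1_(waiting time > i/D)], is charged to step [j] as long as
   consensus is not reached. *)
Let charge j i w : \bar R :=
  (\sum_(sg <- pairs j) (D^-1 * chi sg.1 sg.2)%:E * (\1_(H sg i) w)%:E)%E.

Let term_ge0 sg i w : (0 <= (D^-1 * chi sg.1 sg.2)%:E * (\1_(H sg i) w)%:E)%E.
Proof. by rewrite -EFinM lee_fin !mulr_ge0 ?invr_ge0 // ltW. Qed.

Let charge_ge0 j i w : (0 <= charge j i w)%E.
Proof. by apply: sume_ge0 => sg _. Qed.

Let total w : \bar R := (\sum_(j <oo) \sum_(i <oo) charge j i w)%E.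

Let total_j_ge0 j w : (0 <= \sum_(i <oo) charge j i w)%E.
Proof. by apply: nneseries_ge0 => i _ _. Qed.

Let total_ge0 w : (0 <= total w)%E.
Proof. by apply: nneseries_ge0 => j _ _. Qed.

Let rt w k m : R := \sum_(i < m.+1) X k i w.

Let osc_grid s w (g : {ffun V -> I}) : (forall v, cell (g v) (f0 v w)) ->
  eps < osc (act s (fun v => f0 v w)) -> chi s g = 1.
Proof.
move=> gw /osc_gtP[|u [v uv]]; first exact: ltW.
rewrite /chi; suff -> : eps / 2 < osc (act s (a \o g)) by [].
have close x : `|act s (fun v => f0 v w) x - act s (a \o g) x| <= eps / 4.
  apply: act_dist_le => {}x; apply: le_trans N_eps.
  exact: grid_cell_dist (gw x).
apply: lt_le_trans (osc_ge _ u v).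
have := close u; have := close v; move: uv.
set fu := act s _ u; set fv := act s _ v.
set au := act s (a \o g) u; set av := act s (a \o g) v => uv cv cu.
have : `|fu - fv| <= `|fu - au| + `|au - av| + `|fv - av|.
  apply: le_trans (_ : `|fu - au + (au - av)| + `|fv - av| <= _).
    by rewrite -[X in _ <= _ + X]normrN; apply: le_trans (ler_normD _ _);
      rewrite le_eqVlt; apply/orP; left; apply/eqP; congr `|_|; ring.
  by rewrite lerD2r ler_normD.
lra.
Qed.

(** Up to the first [J] with oscillation at most [eps], the waiting times telescope to the time of
    the [J]-th ring. If there is no such [J], every row contributes at least [1 / D] through its
    term [i = 0] and the total is infinite, so convergence to consensus need not be known
    beforehand. *)
Let consensus_le_total w :
  (forall v, `|f0 v w| <= 1) ->
  (forall j, exists s,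
    [/\ s \in words E j, ring_order E X s w & resid_gt E X s (fun=> 0) w]) ->
  (consensus_time E (rt w) (fun v => f0 v w) eps <= total w)%E.
Proof.
move=> f1 /choice[word Hword].
have wordE j : all (mem E) (word j).
  by have [+ _ _] := Hword j; rewrite mem_words => /andP[].
have size_word j : size (word j) = j.
  by have [+ _ _] := Hword j; rewrite mem_words => /andP[/eqP].
have word_order j : ring_order E X (word j) w by have [] := Hword j.
have word_resid j : resid_gt E X (word j) (fun=> 0) w by have [] := Hword j.
have [g0 Hg0] := choice (fun v => grid_cell_cover N_gt0 (f1 v)).
pose g : {ffun V -> I} := [ffun v => g0 v].
have gw v : cell (g v) (f0 v w) by rewrite ffunE; apply: Hg0.
have charge_ge j i : eps < osc (act (word j) (fun v => f0 v w)) ->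
    (forall k, k \in E -> i%:R / D < resid X (word j) k w) ->
    ((D^-1)%:E <= charge j i w)%E.
  move=> oj ij; rewrite /charge (big_rem (word j, g)) /=; last first.
    apply/allpairsP; exists (word j, g); split; rewrite ?mem_index_enum //.
    by have [] := Hword j.
  rewrite (osc_grid gw oj) mulr1 indicE mem_set; last first.
    by split; [split; [exact: gw|exact: word_order]|exact: ij].
  by rewrite mule1 leeDl // sume_ge0.
have row_ge_inv j : eps < osc (act (word j) (fun v => f0 v w)) ->
    ((D^-1)%:E <= \sum_(i <oo) charge j i w)%E.
  move=> oj; apply: le_trans (nneseries_lim_ge 1 _) => //.
  rewrite big_nat1; apply: charge_ge => // k kE.
  by rewrite mul0r; apply: word_resid.
have row_ge j : eps < osc (act (word j) (fun v => f0 v w)) ->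
    ((last_ring X (word j.+1) w - last_ring X (word j) w)%:E
      <= \sum_(i <oo) charge j i w)%E.
  move=> oj; have [e [We eE ->]] := wordS wordE size_word word_order j.
  rewrite [_ + _]addrC addKr; set rho := resid _ _ _ _.
  have exM : exists M : nat, rho * D <= M%:R.
    have rD : 0 <= rho * D by rewrite mulr_ge0 ?ltW // word_resid.
    exists (Num.truncn (rho * D)).+1.
    by have := truncn_itv rD => /andP[_ /ltW].
  (* [M] is [rho * D] rounded up, so exactly the indices [i < M] satisfy [i / D < rho]. *)
  case: (ex_minnP exM) => M rM minM.
  apply: le_trans (nneseries_lim_ge M _) => //.
  apply: le_trans (_ : (\sum_(0 <= i < M) (D^-1)%:E <= _)%E).
    rewrite sumEFin lee_fin big_const_nat subn0 iter_addr_0.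
    by rewrite -[_ *+ _]mulr_natl ler_pdivlMr.
  rewrite big_nat [leRHS]big_nat; apply: lee_sum => i iM; apply: charge_ge => // k kE.
  apply: lt_le_trans (word_head_min word_order We kE).
  rewrite ltr_pdivrMr // ltNge; apply/negP => /minM.
  by have /andP[_ iM'] := iM; rewrite leqNgt iM'.
have [[J0 oJ0]|noJ] := pselect (exists j,
    osc (act (word j) (fun v => f0 v w)) <= eps).
  have [J oJ minJ] := ex_minnP (ex_intro (fun j =>
    osc (act (word j) (fun v => f0 v w)) <= eps) J0 oJ0).
  apply: le_trans (consensus_time_le wordE size_word word_order word_resid oJ) _.
  apply: le_trans (nneseries_lim_ge J _) => //.
  rewrite big_mkord.
  have : forall n, (n <= J)%N -> ((last_ring X (word n) w)%:E <=
      \sum_(i < n) \sum_(i0 <oo) charge i i0 w)%E.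
    elim=> [_|n IH nJ]; first by rewrite big_ord0 (size0nil (size_word 0%N)).
    rewrite big_ord_recr /=.
    have -> : last_ring X (word n.+1) w = last_ring X (word n) w +
      (last_ring X (word n.+1) w - last_ring X (word n) w) by rewrite addrC subrK.
    rewrite EFinD leeD ?IH ?(ltnW nJ) // row_ge // ltNge; apply/negP => /minJ.
    by rewrite leqNgt nJ.
  exact.
suff -> : total w = +oo%E by rewrite leey.
apply/eqP; rewrite -leye_eq leNgt; apply/negP => fin.
have [r tr] : exists r : R, total w = r%:E.
  exists (fine (total w)); rewrite fineK // ge0_fin_numE //.
have r0 : 0 <= r by rewrite -lee_fin -tr.
have rD : 0 <= r * D by rewrite mulr_ge0 // ltW.
pose n := (Num.truncn (r * D)).+1.
have : ((n%:R / D)%:E <= total w)%E.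
  apply: le_trans (nneseries_lim_ge n _) => //.
  apply: le_trans (_ : (\sum_(0 <= i < n) (D^-1)%:E <= _)%E).
    by rewrite sumEFin lee_fin big_const_nat subn0 iter_addr_0 -[D^-1 *+ _]mulr_natl.
  apply: lee_sum => j _; apply: row_ge_inv; rewrite ltNge; apply/negP => oj.
  by apply: noJ; exists j.
rewrite tr lee_fin ler_pdivrMr // leNgt.
by have := truncn_itv rD => /andP[_ ->].
Qed.

Let measurable_H sg i : measurable (H sg i).
Proof. by apply: measurable_word_event => v; apply: measurable_grid_cell. Qed.

Let measurable_charge j i : measurable_fun setT (charge j i).
Proof.
apply: emeasurable_sum => sg; apply: measurable_funeM.
exact/measurable_EFinP/measurable_indic.
Qed.

Let measurable_total : measurable_fun setT total.
Proof.
apply: (@ge0_emeasurable_sum _ _ _ _ _ xpredT) => //= j _.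
by apply: (@ge0_emeasurable_sum _ _ _ _ _ xpredT).
Qed.

Let v0 : V := enum_val (Ordinal (ltnW V_gt1)).

Let p (i : I) : R := fine (P (f0 v0 @^-1` cell i)).

Let m_cell v i : measurable (f0 v @^-1` cell i).
Proof.
rewrite -[X in measurable X]setTI; apply: measurable_funPT => //.
exact: measurable_grid_cell.
Qed.

Let p_ge0 i : 0 <= p i. Proof. exact: fine_ge0. Qed.

Let p_sum1 : \sum_i p i = 1.
Proof.
apply: EFin_inj; rewrite -sumEFin.
rewrite (eq_bigr (fun i => P (f0 v0 @^-1` cell i))); last first.
  by move=> i _; rewrite fineK // fin_num_measure.
have tI : trivIset [set` index_enum I] (fun i => f0 v0 @^-1` cell i).
  by move=> i j _ _ [w [/= iw jw]]; exact: (@grid_cell_inj R N N_gt0 i j (f0 v0 w)).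
have mU : measurable (\bigcup_(i in [set` index_enum I]) f0 v0 @^-1` cell i).
  by apply: fin_bigcup_measurable => //; exact: finite_seq.
rewrite fsbig_seq ?index_enum_uniq //.
transitivity (P (\bigcup_(i in [set` index_enum I]) f0 v0 @^-1` cell i)).
  by rewrite [RHS]measure_fin_bigcup //; exact: finite_seq.
have negU : P (~` \bigcup_(i in [set` index_enum I]) f0 v0 @^-1` cell i) = 0%E.
  apply/(negligibleP _ (measurableC mU)).
  apply: negligibleS (f0_le1 v0) => w /= nU f1; apply: nU.
  have [i iw] := grid_cell_cover N_gt0 f1.
  by exists i; rewrite //= mem_index_enum.
rewrite -[X in P X]setCK probability_setC; last exact: measurableC.
by rewrite negU sube0.
Qed.

(** All [#|E|] residual clocks exceed [i / D] with probability [expR (- i)], independently of the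
    word and the opinions. *)
Let integral_charge j i : (\int[P]_w charge j i w =
  (D^-1 * disagree_prob E p a j (eps / 2) * expR (- i%:R))%:E)%E.
Proof.
rewrite ge0_integral_sum //; last first.
  by move=> sg; apply: measurable_funeM; exact/measurable_EFinP/measurable_indic.
rewrite (eq_big_seq (fun sg : seq {set V} * {ffun V -> I} => (D^-1 ^+ j * expR (- i%:R) * (D^-1 *
    ((\prod_v p (sg.2 v)) * chi sg.1 sg.2)))%:E)); last first.
  move=> sg sgj; have [sE sj] : all (mem E) sg.1 /\ size sg.1 = j.
    case/allpairsP: sgj => -[s g] /= [+ _ ->] /=.
    by rewrite mem_words => /andP[/eqP].
  rewrite ge0_integralZl_EFin //; last 2 first.
  - exact/measurable_EFinP/measurable_indic.
  - by rewrite mulr_ge0 ?invr_ge0 // ltW.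
  have PH : P (H sg i) = ((\prod_v fine (P (f0 v @^-1` cell (sg.2 v))))
      * D^-1 ^+ j * expR (- i%:R))%:E.
    rewrite /H word_event_prob //; last 2 first.
    - by move=> v; apply: measurable_grid_cell.
    - by rewrite divr_ge0 // ltW.
    by rewrite sj [#|E|%:R * _]mulrC divfK // gt_eqF.
  transitivity ((D^-1 * chi sg.1 sg.2)%:E * P (H sg i))%E.
    by rewrite integral_indic // setIT.
  rewrite PH -EFinM; congr EFin.
  have -> : \prod_v fine (P (f0 v @^-1` cell (sg.2 v))) = \prod_v p (sg.2 v).
    apply: eq_bigr => v _; congr fine.
    exact: (f0_id v v0 (measurable_grid_cell _)).
  by ring.
rewrite sumEFin; congr EFin.
rewrite -!mulr_sumr big_allpairs_dep /disagree_prob /wavg -/D.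
by rewrite -/chi; ring.
Qed.

Lemma expected_consensus_time_le :
  (\int[P]_w consensus_time E (rt w) (fun v => f0 v w) eps <=
   (2 * (6 * (8 * ln #|V|%:R) ^+ 2 * (96 / (eps / 2)) ^+ 4))%:E)%E.
Proof.
have tau_ge0 w : (0 <= consensus_time E (rt w) (fun v => f0 v w) eps)%E.
  by apply: le_ereal_inf_tmp => _ [t [t0 _] <-]; rewrite lee_fin.
apply: le_trans (_ : (\int[P]_w total w <= _)%E).
  apply: integral_le_ae => //.
  have f1 : {ae P, forall w, forall v, `|f0 v w| <= 1}.
    by apply: filter_forall => v; apply: f0_le1.
  apply: filterS2 f1 (ae_ring_order E_gt0 expX indep) => w.
  exact: consensus_le_total.
rewrite integral_nneseries //; last first.
  by move=> j; apply: (@ge0_emeasurable_sum _ _ _ _ _ xpredT).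
have e2 : 0 < eps / 2 by rewrite divr_gt0.
apply: lime_le; first by apply: is_cvg_nneseries => j _ _; apply: integral_ge0.
near=> n; rewrite big_mkord.
have row_le j : (\int[P]_w \sum_(i <oo) charge j i w
    <= (2 * (D^-1 * disagree_prob E p a j (eps / 2)))%:E)%E.
  rewrite integral_nneseries //.
  apply: lime_le; first by apply: is_cvg_nneseries => i _ _; apply: integral_ge0.
  near=> M; rewrite big_mkord.
  rewrite (eq_bigr (fun i : 'I_M =>
    (D^-1 * disagree_prob E p a j (eps / 2) * expR (- i%:R))%:E)); last first.
    by move=> i _; apply: integral_charge.
  rewrite sumEFin lee_fin -mulr_sumr mulrC ler_wpM2r ?sum_expRN_le2 //.
  rewrite mulr_ge0 ?invr_ge0 ?(ltW D_gt0) //; exact: disagree_prob_ge0.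
apply: le_trans (_ : (\sum_(j < n)
    (2 * (D^-1 * disagree_prob E p a j (eps / 2)))%:E <= _)%E).
  by apply: lee_sum => j _; apply: row_le.
rewrite sumEFin lee_fin -mulr_sumr ler_wpM2l // -mulr_sumr.
by apply: sum_disagree_prob_le => //; apply: grid_point_le1.
Unshelve. all: by end_near. Qed.

End ExpectedConsensusTime.

(** On a single vertex [ln 1 = 0] makes the bound 0, so the consensus time has to vanish exactly. *)
Lemma consensus_time_card_le1 (R : realType) (V : finType) (E : {set {set V}})
    (rt : {set V} -> nat -> R) (f : V -> R) (eps : R) :
  simple_graph E -> (#|V| <= 1)%N -> 0 < eps -> consensus_time E rt f eps = 0%E.
Proof.
move=> simpleE V1 eps0.
have noE k : k \notin E.
  apply/negP => /simpleE k2; have := leq_trans (max_card (mem k)) V1.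
  by rewrite k2.
apply/eqP; rewrite eq_le; apply/andP; split; last first.
  by apply: le_ereal_inf_tmp => _ [t [t0 _] <-]; rewrite lee_fin.
apply: ereal_inf_lbound; exists 0 => //; split=> //; exists f; split.
  exists 0%N; split=> //; split=> // s.
  by rewrite /ev_time /next_edge; case: pickP => [k|//]; rewrite (negbTE (noE k)).
apply: osc_le => [|u v]; first exact: ltW.
have -> : u = v by apply: (fintype_le1P V1).
by rewrite subrr normr0 ltW.
Qed.

Lemma connected_graph_edge (V : finType) (E : {set {set V}}) :
  connected_graph E -> (1 < #|V|)%N -> (0 < #|E|)%N.
Proof.
move=> connE V1; pose u : V := enum_val (Ordinal (ltnW V1)).
pose v : V := enum_val (Ordinal V1).
have uv : u != v by apply/eqP => /enum_val_inj /(congr1 val).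
have /connectP[[|y p] /= uyP vE] := connE u v; first by rewrite vE eqxx in uv.
by apply/card_gt0P; exists [set u; y]%SET; case/andP: uyP.
Qed.

(* The clock of edge k is a rate-one Poisson process whose interarrival
   times X k 0, X k 1, ... are i.i.d. Exp(1); its (m+1)-th ring is at
   time X k 0 + ... + X k m. *)
Theorem theorem1p1 :
  exists C : RR, 0 < C /\
  forall (V : finType) (E : {set {set V}}),
    simple_graph E -> connected_graph E ->
  forall (d : measure_display) (T : measurableType d)
         (P : probability T RR)
         (f0 : V -> {RV P >-> RR})
         (X : {set V} -> nat -> {RV P >-> RR}),
    (* initial opinions identically distributed *)
    (forall u v (A : set RR), measurable A ->
       distribution P (f0 u) A = distribution P (f0 v) A) ->
    (* |f_0(v)| <= 1 almost surely *)
    (forall v, {ae P, forall w, `|f0 v w| <= 1}) ->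
    (* interarrival times of the clocks are Exp(1) *)
    (forall k m (A : set RR), k \in E -> measurable A ->
       distribution P (X k m) A = exponential_prob 1 A) ->
    (* initial opinions and all clock variables are mutually independent *)
    mutually_independent P (ea_index E)
      (fun i => match i with
                | inl v => (f0 v : T -> RR)
                | inr km => (X km.1 km.2 : T -> RR)
                end) ->
  forall eps : RR, 0 < eps ->
    (\int[P]_w consensus_time E
        (fun k m => (\sum_(i < m.+1) (X k i w : RR))%R) (fun v => f0 v w) eps
     <= (C * (ln (#|V|%:R : RR)) ^+ 2 / eps ^+ 4)%:E)%E.
Proof.
(* The leading 2 is lost in rounding waiting times up, 6 in the tail sum; 8 combines the 16 in the
   cutoff [B] with [ln (2 n) <= 2 ln n], and the 2 beside [c] undoes the passage to [eps / 2]. *)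
pose C (c : RR) := 2 * (6 * 8 ^+ 2 * (c * 2) ^+ 4).
exists (C 96); split.
  by rewrite /C; do 2 (apply: mulr_gt0; first by []); apply: exprn_gt0; apply: mulr_gt0.
move=> V E simpleE connE d T P f0 X f0_id f0_le1 expX indep eps eps0.
have [V_gt1|V_le1] := ltnP 1 #|V|; last first.
  rewrite (eq_integral (cst 0%E)); last first.
    by move=> w _; rewrite consensus_time_card_le1.
  rewrite integral0 lee_fin divr_ge0 ?exprn_ge0 ?(ltW eps0) // mulr_ge0 ?sqr_ge0 //.
  by rewrite /C; do 2 (apply: mulr_ge0; first by []); apply: exprn_ge0; apply: mulr_ge0.
have E_gt0 := connected_graph_edge connE V_gt1.
have e4 : 0 <= 4 / eps by rewrite divr_ge0 // ltW.
pose N := (Num.truncn (4 / eps)).+1.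
have N_eps : N%:R^-1 <= eps / 4.
  have /andP[_ /ltW HN] := truncn_itv e4.
  rewrite -[eps / 4]invrK lef_pV2 ?posrE ?invr_gt0 ?divr_gt0 ?ltr0n //.
  by rewrite invf_div.
have -> : C 96 * ln #|V|%:R ^+ 2 / eps ^+ 4 =
    2 * (6 * (8 * ln #|V|%:R) ^+ 2 * (96 / (eps / 2)) ^+ 4).
  by rewrite /C; move: (96 : RR) => c; field; rewrite gt_eqF.
exact: (expected_consensus_time_le simpleE connE E_gt0 V_gt1 f0_id f0_le1 expX indep
  eps0 (N := N) isT N_eps).
Qed.
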